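(* If $G$ is a subcubic planar graph without 4-cycles and 5-cycles, then $\chi_{\ell}(G^2) \leq 7$.
   Context: Graphs are finite and simple. A graph $G$ is subcubic if its maximum degree satisfies $\Delta(G)\le 3$. A $k$-cycle is a cycle of length $k$; ''without $k$-cycles'' means that $G$ contains no $k$-cycle as a (not necessarily induced) subgraph. The square $G^2$ of a graph $G$ has the same vertex set as $G$, and two distinct vertices are adjacent in $G^2$ if and only if their distance in $G$ is at most $2$. A list assignment $L$ for a graph assigns to each vertex $v$ a set $L(v)$ of available colors; the graph is $L$-colorable if it has a proper coloring $f$ with $f(v)\in L(v)$ for every vertex $v$. A graph is $k$-choosable if it is $L$-colorable whenever all lists $L(v)$ have size $k$. The list chromatic number $\chi_{\ell}(G)$ is the minimum $k$ such that $G$ is $k$-choosable. *)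

(* Defs.v *)
From mathcomp Require Import all_boot all_order all_algebra.
From mathcomp Require Import finmap.
From mathcomp Require Import boolp classical_sets reals.

Set Implicit Arguments.
Unset Strict Implicit.
Unset Printing Implicit Defensive.

Import Order.TTheory GRing.Theory Num.Theory.

Local Open Scope nat_scope.

(** * Finite simple graphs *)

Record sgraph := SGraph {
  vertex :> finType;
  adj : rel vertex;
  adj_sym : symmetric adj;
  adj_irrefl : irreflexive adj }.

Arguments adj {_}.

Definition degree (G : sgraph) (x : G) : nat := #|[set y | adj x y]|.

Definition subcubic (G : sgraph) : Prop := forall x : G, degree x <= 3.

(** Meaningful for [2 < k]: the subgraph may have chords in [G]. *)
Definition has_cycle (k : nat) (G : sgraph) : Prop :=
  exists2 c : seq G, ucycle adj c & size c = k.

(** [dist_le n x y] says that the distance of [x] and [y] is at most [n]: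
    [{bseq n of G}] is the type of vertex sequences of length at most [n], so
    [x :: p] is a walk with at most [n] edges. *)
Definition dist_le (G : sgraph) (n : nat) (x y : G) : bool :=
  [exists p : {bseq n of G}, path adj x p && (last x p == y)].

Lemma dist_le_sym (G : sgraph) (n : nat) : symmetric (@dist_le G n).
Proof.
suff dist_leW x y : @dist_le G n x y -> @dist_le G n y x.
  by move=> x y; apply/idP/idP; apply: dist_leW.
case/existsP=> p /andP[xp /eqP <-].
have sz_p : size (rev (belast x p)) <= n.
  by rewrite size_rev size_belast size_bseq.
apply/existsP; exists (Bseq sz_p); apply/andP; split => /=.
  rewrite rev_path; apply: sub_path xp => u v uv.
  by rewrite /= adj_sym.
by case: (p : seq G) => //= z q; rewrite rev_cons last_rcons.
Qed.

Definition square_adj (G : sgraph) : rel G :=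
  [rel x y | (x != y) && dist_le 2 x y].

Lemma square_adj_sym (G : sgraph) : symmetric (@square_adj G).
Proof. by move=> x y; rewrite /square_adj /= eq_sym dist_le_sym. Qed.

Lemma square_adj_irrefl (G : sgraph) : irreflexive (@square_adj G).
Proof. by move=> x; rewrite /square_adj /= eqxx. Qed.

Definition square (G : sgraph) : sgraph :=
  SGraph (@square_adj_sym G) (@square_adj_irrefl G).

(** * List colouring *)

Definition list_colorable (G : sgraph) (C : choiceType) (L : G -> {fset C}) :
    Prop :=
  exists f : G -> C,
    (forall v, f v \in L v) /\ (forall u v, adj u v -> f u <> f v).

Definition choosable (k : nat) (G : sgraph) : Prop :=
  forall (C : choiceType) (L : G -> {fset C}),
    (forall v, #|` L v| = k) -> list_colorable L.

Lemma choosable_order (G : sgraph) : choosable #|G| G.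
Proof.
move=> C L szL.
suff [f [fL f_inj]] : exists f : G -> C,
    (forall v, f v \in L v) /\ {in enum G &, injective f}.
  exists f; split=> // u v uv fuv.
  have uEv : u = v by apply: f_inj; rewrite ?mem_enum.
  by rewrite uEv adj_irrefl in uv.
have : uniq (enum G) && (size (enum G) <= #|G|).
  by rewrite enum_uniq -cardE leqnn.
elim: (enum G) => [_|x s IHs /= /andP[/andP[xNs s_uniq] s_lt]].
  have L_n0 v : exists c, c \in L v.
    by apply/fset0Pn; rewrite -cardfs_gt0 szL; apply/card_gt0P; exists v.
  exists (fun v => xchoose (L_n0 v)); split=> // v.
  exact: xchooseP.
have [|f [fL f_inj]] := IHs; first by rewrite s_uniq ltnW.
have [c /fsetDP[cL cNs]] : exists c, c \in (L x `\` [fset f y | y in s])%fset.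
  apply/fset0Pn; rewrite -cardfs_gt0 cardfsD subn_gt0 szL.
  apply: leq_ltn_trans s_lt.
  apply: leq_trans (fsubset_leq_card (fsubsetIr _ _)) _.
  apply: leq_trans (leq_imfset_card _ _ _) _.
  by rewrite size_undup.
have fNc y : y \in s -> f y <> c.
  by move=> ys fyc; case/negP: cNs; apply/imfsetP; exists y.
exists (fun y => if y == x then c else f y); split=> [v|u v].
  by case: eqP => [->|_].
rewrite !inE; case: eqP => [-> _|_ /= us]; case: eqP => [-> _|_ /= vs] //.
- by move=> /esym /(fNc _ vs).
- by move=> /(fNc _ us).
- exact: f_inj.
Qed.

Lemma ex_choosable (G : sgraph) : exists k, `[< choosable k G >].
Proof. by exists #|G|; apply/asboolP; apply: choosable_order. Qed.

Definition list_chromatic_number (G : sgraph) : nat := ex_minn (ex_choosable G).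

(** * Planar graphs *)

Section Planar.
Variable R : realType.
Local Notation point := ('rV[R]_2).
Local Open Scope ring_scope.
Local Open Scope classical_set_scope.

Definition segment (a b : point) : set point :=
  [set z | exists2 t : R, 0 <= t <= 1 & z = (1 - t) *: a + t *: b].

(** The sequence [s] lists the successive break points of a polygonal line. *)
Definition polyline (s : seq point) : set point :=
  [set z | exists2 i : nat, (i.+1 < size s)%N & segment s`_i s`_i.+1 z].

(** The last clause makes [polyline s] homeomorphic to a closed interval. *)
Definition polygonal_arc (a b : point) (s : seq point) : Prop :=
  [/\ (1 < size s)%N, s`_0 = a, last 0 s = b, uniq s &
      forall (i j : nat) (z : point), (i < j)%N -> (j.+1 < size s)%N ->
        segment s`_i s`_i.+1 z -> segment s`_j s`_j.+1 z ->
        j = i.+1 /\ z = s`_j].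

(** A drawing without crossings: vertices are distinct points, edges are
    polygonal arcs joining their ends, and the interior of an edge contains
    neither a vertex nor a point of another edge.  As edges are undirected,
    [arc x y] and [arc y x] are the same arc, run in opposite directions.
    Edges could equivalently be arbitrary simple curves; polygonal arcs are the
    convention of Diestel's textbook. *)
Record plane_drawing (G : sgraph) (pos : G -> point)
    (arc : G -> G -> seq point) : Prop := PlaneDrawing {
  pos_inj : injective pos;
  arc_rev : forall x y, adj x y -> arc y x = rev (arc x y);
  arc_polygonal : forall x y, adj x y ->
    polygonal_arc (pos x) (pos y) (arc x y);
  arc_vertex : forall x y z, adj x y ->
    polyline (arc x y) (pos z) -> z = x \/ z = y;
  arc_disjoint : forall x y x' y' p, adj x y -> adj x' y' ->
    [set x; y]%SET != [set x'; y']%SET ->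
    polyline (arc x y) p -> polyline (arc x' y') p ->
    p = pos x \/ p = pos y }.

Definition planar (G : sgraph) : Prop :=
  exists (pos : G -> point) (arc : G -> G -> seq point), plane_drawing pos arc.

End Planar.

(* Main.v *)
Require Import Defs.
From mathcomp Require Import all_boot all_order all_algebra.
From mathcomp Require Import finmap zify ring lra.
From mathcomp Require Import boolp reals.

Set Implicit Arguments.
Unset Strict Implicit.
Unset Printing Implicit Defensive.

(** A graph is handled as a relation [e] on a fixed finite type, in which
    isolated points are harmless: deleting edges and suppressing a vertex of
    degree two then never change the type.  The colouring argument keeps a
    single consequence of planarity, the predicate [sparse]: every nonempty
    subgraph without vertices of degree one has a cycle through at most five of
    its vertices of degree three.

    Planar graphs are sparse ([planar_sparse]).  Let [z] be an even set of edges
    of a drawing, and attach to each dart (oriented edge) the parity of the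
    number of edges of [z] above a point close to its left side.  This function
    of darts is constant along facial walks, and its values on the two sides of
    an edge differ exactly when the edge is in [z].  Hence there are at most
    [2 ^ (F - 1)] even sets, where [F] counts the facial walks; as there are at
    least [2 ^ (E - V)] of them, [E < V + F] ([euler]), which is the half of
    Euler's formula that matters.  If all cycles had six vertices of degree
    three, each facial walk would have six darts starting at such vertices,
    so that [6 F <= 3 n] for the number [n] of vertices of degree three,
    while [E - V = n / 2] ([short_cycle]).  The two properties of the parities
    come from one identity about two noncrossing segments ([crossing_parity]),
    summed over all segments of the drawing.

    Sparse subcubic graphs without 4-cycles and 5-cycles have 7-choosable
    squares ([good_colorable]).  Consider a counterexample with fewest edges.  A
    vertex of degree two has at most six neighbours in the square, so only the
    condition that its two neighbours get different colours can fail.  If the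
    vertex lies on a 6-cycle, five vertices of that cycle can be recoloured
    ([two_vertex_hexagon]); otherwise suppressing it creates no short cycle and
    makes the two neighbours adjacent ([no_two_vertex]).  So every vertex that
    is not isolated has degree three.  Three configurations can be deleted and coloured last: a 6-cycle
    through an edge of a triangle ([hexagon_triangle]), two triangles joined by
    an edge ([joined_triangles]), and two triangles joined by a path of length
    two ([linked_triangles]).  Removing one edge of every triangle, and applying
    sparseness to the rest, gives a cycle with at most five vertices of degree
    three.  No triangle survives and its length is not four or five, so it has
    vertices of degree two, which are corners of triangles.  The last two
    configurations show that next to each triangle the cycle has two vertices
    in no triangle on either side, and the triangle itself contributes a vertex
    of degree three.  That makes five, so the cycle consists of these and one or
    two more corners of a single triangle: it is, up to bypassing a corner, a
    6-cycle through an edge of that triangle ([heavy_in_cut_cycle]). *)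

(** * List colouring of small configurations *)

Section ListLemmas.
Variable C : choiceType.
Implicit Types (A B D M P Q U V X Y Z : {fset C}) (s : seq C).

Lemma pick_avoid A s : size s < #|` A| -> exists2 c, c \in A & c \notin s.
Proof.
move=> ltsA.
have [c /fsetDP[cA cs]] : exists c, c \in (A `\` [fset x in s])%fset.
  apply/fset0Pn; rewrite -cardfs_gt0 cardfsD subn_gt0.
  apply: leq_ltn_trans ltsA.
  apply: leq_trans (fsubset_leq_card (fsubsetIr _ _)) _.
  by apply: leq_trans (leq_imfset_card _ _ _) _; rewrite size_undup.
by exists c => //; move: cs; rewrite !inE.
Qed.

Lemma pick_diff A B : #|` B| < #|` A| -> exists2 c, c \in A & c \notin B.
Proof.
move=> ltBA; have [c cA cB] := @pick_avoid A (enum_fset B) ltBA.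
by exists c.
Qed.

Lemma card_rem A c : #|` A| <= (#|` (A `\ c)%fset|).+1.
Proof.
by rewrite (cardfsD1 c A); case: (c \in A) => /=; rewrite ?add1n // add0n leqnSn.
Qed.

Lemma card_rem_notin A c : c \notin A -> #|` (A `\ c)%fset| = #|` A|.
Proof. by move=> cA; rewrite [RHS](cardfsD1 c A) (negPf cA). Qed.

(** The lists belong to five vertices of a hexagon whose sixth vertex has
    degree two, and [c], [x], [y], [z], [c] is a colouring of these five in
    which the two neighbours of the sixth agree.  The sizes alone do not suffice,
    as the three short lists may coincide; the given colouring excludes that.
    Unless the first or the last vertex can be recoloured on its own, their
    lists contain [c; x; y] and [c; y; z]; what remains is a case distinction on
    the second colours of the three short lists. *)
Lemma hexagon_recolor A1 A2 A3 A4 A5 c x y z :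
  2 < #|` A1| -> 1 < #|` A2| -> 1 < #|` A3| -> 1 < #|` A4| -> 2 < #|` A5| ->
  x \in A2 -> y \in A3 -> z \in A4 -> c \in A1 -> c \in A5 ->
  uniq [:: c; x; y; z] ->
  exists c1 c2 c3 c4 c5,
    [/\ c1 \in A1, c2 \in A2, c3 \in A3, c4 \in A4 & c5 \in A5] /\
    [/\ c1 != c2, c1 != c3, c2 != c3, c2 != c4 & 
    [/\ c3 != c4, c3 != c5, c4 != c5 & c1 != c5]].
Proof.
move=> s1 s2 s3 s4 s5 xA yA zA c1A c5A.
rewrite /= !inE !negb_or -!andbA => /and4P[cx cy cz /and4P[xy xz yz _]].
pose good c1 c2 c3 c4 c5 := [&& c1 \in A1, c2 \in A2, c3 \in A3, c4 \in A4,
  c5 \in A5 & [&& c1 != c2, c1 != c3, c2 != c3, c2 != c4,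
  c3 != c4, c3 != c5, c4 != c5 & c1 != c5]].
suff [c1 [c2 [c3 [c4 [c5]]]]] : exists c1 c2 c3 c4 c5, good c1 c2 c3 c4 c5.
  by move=> /and5P[? ? ? ? /andP[? /and5P[? ? ? ? /and4P[? ? ? ?]]]];
     exists c1, c2, c3, c4, c5.
have [[xc yc zc] [yx zx zy]] :
    [/\ x != c, y != c & z != c] /\ [/\ y != x, z != x & z != y].
  by rewrite !(eq_sym _ c) (eq_sym y) !(eq_sym z).
have [a aA] := @pick_avoid A1 [:: c; x] s1; rewrite !inE negb_or => /andP[ac ax].
case: (eqVneq a y) => [ay|ay]; last first.
  exists a, x, y, z, c; rewrite /good aA xA yA zA c5A ac ax ay xy xz yz yc zc.
  by [].
subst a.
have [a aA'] := @pick_avoid A1 [:: c; y] s1; rewrite !inE negb_or => /andP[ac' ay'].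
case: (eqVneq a x) => [ax'|ax']; last first.
  exists a, x, y, z, c; rewrite /good aA' xA yA zA c5A ac' ax' ay' xy xz yz yc zc.
  by [].
subst a.
have [b bA] := @pick_avoid A5 [:: c; z] s5; rewrite !inE negb_or => /andP[bc bz].
case: (eqVneq b y) => [by'|by']; last first.
  exists c, x, y, z, b; rewrite /good bA xA yA zA c1A xy xz yz cx cy.
  by rewrite !(eq_sym _ b) by' bz bc.
subst b.
have [b bA'] := @pick_avoid A5 [:: c; y] s5; rewrite !inE negb_or => /andP[bc' by'].
case: (eqVneq b z) => [bz'|bz']; last first.
  exists c, x, y, z, b; rewrite /good bA' xA yA zA c1A xy xz yz cx cy.
  by rewrite !(eq_sym _ b) by' bz' bc'.
subst b => {ac ax ac' ay' bc bz bc' by' s1 s5}.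
have [x' x'A] := @pick_avoid A2 [:: x] s2; rewrite inE => x'x.
have [y' y'A] := @pick_avoid A3 [:: y] s3; rewrite inE => y'y.
have [z' z'A] := @pick_avoid A4 [:: z] s4; rewrite inE => z'z {s2 s3 s4}.
have xx' : x != x' by rewrite eq_sym.
have yy' : y != y' by rewrite eq_sym.
have zz' : z != z' by rewrite eq_sym.
pose inA := (xA, yA, zA, x'A, y'A, z'A, aA, aA', bA, bA', c1A, c5A).
pose ne := (cx, cy, cz, xc, yc, zc, (xy, xz, yz, yx, zx, zy), (x'x, y'y, z'z, xx', yy', zz')).
case: (eqVneq x' y) => [x'y|x'y]; [subst x'|case: (eqVneq x' z) => [x'z|x'z]; [subst x'|]]; last first.
- by exists x, x', y, z, c; rewrite /good !inA !ne x'y x'z.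
- case: (eqVneq z' y) => [z'y|z'y]; [subst z'|case: (eqVneq z' x) => [z'x|z'x]; [subst z'|]]; last first.
  + by exists c, x, y, z', z; rewrite /good !inA !ne !(eq_sym _ z') !(z'y, z'x).
  + by exists x, z, y, x, c; rewrite /good !inA !ne.
  + case: (eqVneq y' c) => [y'c|y'c]; first by subst y'; exists x, z, c, y, z; rewrite /good !inA !ne.
    case: (eqVneq y' x) => [y'x|y'x]; first by subst y'; exists c, z, x, y, z; rewrite /good !inA !ne.
    case: (eqVneq y' z) => [y'z|y'z]; first by subst y'; exists y, x, z, y, c; rewrite /good !inA !ne.
    exists y, x, y', z, c; rewrite /good !inA !ne (eq_sym x y') y'x y'z y'c.
    by [].
- case: (eqVneq y' c) => [y'c|y'c].
    by subst y'; exists x, y, c, z, y; rewrite /good !inA !ne.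
  case: (eqVneq y' x) => [y'x|y'x]; first by subst y'; exists c, y, x, z, y; rewrite /good !inA !ne.
  case: (eqVneq y' z) => [y'z|y'z]; last first.
    by exists y, x, y', z, c; rewrite /good !inA !ne (eq_sym x y') y'x y'z y'c.
  subst y'; case: (eqVneq z' y) => [z'y|z'y].
    by subst z'; exists y, x, z, y, c; rewrite /good !inA !ne.
  case: (eqVneq z' x) => [z'x|z'x].
    by subst z'; exists x, y, z, x, c; rewrite /good !inA !ne.
  by exists c, x, y, z', z; rewrite /good !inA !ne !(eq_sym _ z') !(z'y, z'x).
Qed.

Lemma card_remP A c k : k < #|` A| -> k <= #|` (A `\ c)%fset|.
Proof. by move=> kA; rewrite -ltnS; apply: leq_trans kA (card_rem A c). Qed.

(** If [B] has exactly [k] colours, then [A], having more, offers one outside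
    [B]; if [B] has more, any colour of [A] will do. *)
Lemma pick_sparing A B k : k < #|` A| -> k <= #|` B| ->
  exists2 c, c \in A & k <= #|` (B `\ c)%fset|.
Proof.
move=> kA; rewrite leq_eqVlt => /predU1P[kB|kB].
  rewrite {1}kB in kA; have [c cA cB] := pick_diff kA.
  by exists c => //; rewrite card_rem_notin // -kB.
have [|c cA _] := @pick_avoid A [::]; first by apply: leq_ltn_trans kA.
by exists c => //; apply: card_remP.
Qed.

(** Three pairwise adjacent vertices with two colours each violate Hall's
    condition only when the three lists coincide. *)
Lemma triangle_color A B D :
  1 < #|` A| -> 1 < #|` B| -> 1 < #|` D| -> A != B \/ 2 < #|` A| ->
  exists a b d, [/\ a \in A, b \in B & d \in D] /\ [/\ a != b, a != d & b != d].
Proof.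
have ne_color (X Y : {fset C}) : 1 < #|` D| -> 1 < #|` Y| -> (exists2 a, a \in X & a \notin Y) ->
  exists a b d, [/\ a \in X, b \in Y & d \in D] /\ [/\ a != b, a != d & b != d].
  move=> sD sY [a aX aY].
  have [d dD] := @pick_avoid D [:: a] sD; rewrite inE => da.
  have [b bY] := @pick_avoid Y [:: d] sY; rewrite inE => bd.
  by exists a, b, d; rewrite (eq_sym a d) da; split=> //; split=> //; apply: contraNneq aY => ->.
move=> sA sB sD [|sA3]; last first.
  have [d dD _] := @pick_avoid D [::] (ltnW sD).
  have [b bB] := @pick_avoid B [:: d] sB; rewrite inE => bd.
  have [a aA] := @pick_avoid A [:: b; d] sA3; rewrite !inE negb_or => /andP[ab ad].
  by exists a, b, d.
rewrite eqEfsubset negb_and => /orP[/fsubsetPn[a aA aB]|/fsubsetPn[a aB aA]].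
  by apply: ne_color sD sB _; exists a.
have [|b [a' [d [[? ? ?] [ba ? ?]]]]] := ne_color B A sD sA; first by exists a.
by exists a', b, d; split=> //; split=> //; rewrite eq_sym.
Qed.

(** Triangles [x y z] and [x' u v] with the edge [x x'].  The colour of [x] is
    taken so as to leave three colours to [y], then that of [x'] so as to leave
    three to [u], not counting [x]; after that [z], [y], [v], [u] are coloured
    greedily. *)
Lemma joined_triangles_color X Y Z X' U V :
  4 < #|` X| -> 2 < #|` Y| -> 2 < #|` Z| ->
  4 < #|` X'| -> 2 < #|` U| -> 2 < #|` V| ->
  exists x y z x' u v,
  [/\ [/\ x \in X, y \in Y & z \in Z], [/\ x' \in X', u \in U & v \in V],
      uniq [:: x; y; z; x'] & uniq [:: x; x'; u; v]].
Proof.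
move=> sX sY sZ sX' sU sV.
have [x xX sYx] := pick_sparing (ltnW sX) sY.
have [x'] := pick_sparing (card_remP x sX') sU.
rewrite !inE => /andP[x'x x'X] sUx'.
have [z zZ] := @pick_avoid Z [:: x; x'] sZ; rewrite !inE => zxx'.
have [y] := @pick_avoid (Y `\ x)%fset [:: x'; z] sYx.
rewrite !inE !negb_or => /andP[yx yY] /andP[yx' yz].
have [v vV] := @pick_avoid V [:: x; x'] sV; rewrite !inE => vxx'.
have [u] := @pick_avoid (U `\ x')%fset [:: x; v] sUx'.
rewrite !inE !negb_or => /andP[ux' uU] /andP[ux uv].
exists x, y, z, x', u, v; split=> //=; rewrite !inE !negb_or.
  rewrite yz yx' !(eq_sym x) yx x'x; move: zxx'; rewrite negb_or => /andP[-> ->].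
  by [].
rewrite uv !(eq_sym x') !(eq_sym x) ux ux' x'x; move: vxx'; rewrite negb_or => /andP[-> ->].
by [].
Qed.

(** Triangles [x y z] and [x' u v] with a common neighbour [m] of [x] and [x'],
    coloured greedily in the order [m v u x' x z y], where [m] is taken so as to
    leave three colours to [y]. *)
Lemma linked_triangles_color M X Y Z X' U V :
  3 < #|` M| -> 3 < #|` X| -> 2 < #|` Y| -> 2 < #|` Z| ->
  3 < #|` X'| -> 2 < #|` U| -> 2 < #|` V| ->
  exists m x y z x' u v,
  [/\ [/\ m \in M, x \in X, y \in Y & z \in Z], [/\ x' \in X', u \in U & v \in V],
      uniq [:: m; x; y; z], uniq [:: m; x'; u; v] & x != x'].
Proof.
move=> sM sX sY sZ sX' sU sV.
have [m mM sYm] := pick_sparing sM sY.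
have [v vV] := @pick_avoid V [:: m] (ltnW sV); rewrite !inE => vm.
have [u uU] := @pick_avoid U [:: m; v] sU; rewrite !inE negb_or => /andP[um uv].
have [x' xX'] := @pick_avoid X' [:: m; u; v] sX'; rewrite !inE !negb_or => /and3P[x'm x'u x'v].
have [x xX] := @pick_avoid X [:: m; x'] (ltnW sX); rewrite !inE negb_or => /andP[xm xx'].
have [z zZ] := @pick_avoid Z [:: m; x] sZ; rewrite !inE negb_or => /andP[zm zx].
have [y] := @pick_avoid (Y `\ m)%fset [:: x; z] sYm.
rewrite !inE !negb_or => /andP[ym yY] /andP[yx yz].
exists m, x, y, z, x', u, v; split=> //=; rewrite !inE !negb_or.
  by rewrite yz !(eq_sym m) (eq_sym x y) (eq_sym x z) xm ym yx zm zx.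
by rewrite !(eq_sym m) um vm x'm x'u x'v uv.
Qed.

(** A hexagon [c0 ... c5] and a triangle [c0 c1 z].  Any colouring of
    [c2 ... c5] leaves two colours to each of [c0], [c1], [z], so that only equal
    remaining lists obstruct.  Since [c1] sees [c3] and [z] does not, at most one
    choice of the colour of [c3] makes the remaining lists of [c1] and [z] equal
    and of size two. *)
Lemma hexagon_triangle_color P0 P1 Z P2 P3 P4 P5 :
  4 < #|` P0| -> 4 < #|` P1| -> 3 < #|` Z| -> 2 < #|` P2| -> 1 < #|` P3| ->
  1 < #|` P4| -> 2 < #|` P5| ->
  exists c0 c1 z c2 c3 c4 c5,
  [/\ [/\ c0 \in P0, c1 \in P1 & z \in Z],
      [/\ c2 \in P2, c3 \in P3, c4 \in P4 & c5 \in P5],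
      uniq [:: c0; c1; z], uniq [:: c2; c3; c4] & uniq [:: c3; c4; c5]] /\
  [/\ c0 \notin [:: c2; c4; c5], c1 \notin [:: c2; c3; c5] & z \notin [:: c2; c5]].
Proof.
move=> s0 s1 sZ s2 s3 s4 s5.
have [c3 c3P c3Z] : exists2 c3, c3 \in P3 & (P1 `\ c3)%fset != Z \/ 4 < #|` Z|.
  have [p pP _] := @pick_avoid P3 [::] (ltnW s3).
  have [p' p'P] := @pick_avoid P3 [:: p] s3; rewrite inE => p'p.
  case: (eqVneq (P1 `\ p)%fset Z) => [pZ|pZ]; last by exists p => //; left.
  case: (eqVneq (P1 `\ p')%fset Z) => [p'Z|p'Z]; last by exists p' => //; left.
  exists p => //; right; rewrite -pZ card_rem_notin //.
  apply/negP => pP1; have : p \in Z by rewrite -p'Z !inE eq_sym p'p.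
  by rewrite -pZ !inE eqxx.
have [c4 c4P] := @pick_avoid P4 [:: c3] s4; rewrite inE => c43.
have [c2 c2P] := @pick_avoid P2 [:: c3; c4] s2; rewrite !inE negb_or => /andP[c23 c24].
have [c5 c5P] := @pick_avoid P5 [:: c3; c4] s5; rewrite !inE negb_or => /andP[c53 c54].
set Q := (P1 `\ c3)%fset in c3Z.
have sQ : 3 < #|` Q| by apply: card_remP.
have s1' : 1 < #|` (Q `\ c2 `\ c5)%fset| by do 2!apply: card_remP.
have sZ' : 1 < #|` (Z `\ c2 `\ c5)%fset| by do 2!apply: card_remP.
have s0' : 1 < #|` (P0 `\ c2 `\ c4 `\ c5)%fset| by do 3!apply: card_remP.
have := triangle_color s1' sZ' s0'; case.
  case: c3Z => [QZ|sZ5]; last first.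
    case: eqVneq => [->|_]; last by left.
    by right; do 2!apply: card_remP.
  case: eqVneq => [eqQZ|_]; last by left.
  right; rewrite ltnNge; apply/negP => le2.
  have split_card (X : {fset C}) : 3 < #|` X| -> #|` (X `\ c2 `\ c5)%fset| <= 2 -> c2 \in X /\ c5 \in X.
    move=> sX leX; split; apply/negPn/negP => cX.
      have : 2 < #|` (X `\ c2 `\ c5)%fset| by apply: card_remP; rewrite card_rem_notin.
      by rewrite ltnNge leX.
    have : 2 < #|` (X `\ c2 `\ c5)%fset|.
      rewrite card_rem_notin; first by apply: card_remP.
      by rewrite !inE negb_and cX orbT.
    by rewrite ltnNge leX.
  have [c2Q c5Q] := split_card Q sQ le2.
  have [|c2Z c5Z] := split_card Z sZ; first by rewrite -eqQZ.
  case/eqP: QZ; apply/fsetP => t; move/fsetP/(_ t): eqQZ; rewrite 4!in_fsetD1.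
  case: (eqVneq t c5) => [->|_]; first by rewrite c5Q c5Z.
  by case: (eqVneq t c2) => [->|_] //=; rewrite c2Q c2Z.
move=> c1 [z [c0 [[]]]]; rewrite !inE => /and4P[c15 c12 c13 c1P].
move=> /and3P[z5 z2 zZ] /and4P[c05 c04 c02 c0P] [c1z c10 z0].
exists c0, c1, z, c2, c3, c4, c5; split.
  split; rewrite //= ?inE ?negb_or.
  - by rewrite !(eq_sym c0) c10 z0 c1z.
  - by rewrite c23 c24 eq_sym c43.
  by rewrite eq_sym c43 !(eq_sym _ c5) c53 c54.
by rewrite !inE !negb_or c02 c04 c05 c12 c13 c15 z2 z5.
Qed.

End ListLemmas.

(** * Graphs as relations on a fixed type *)

Section Relations.
Variable T : finType.
Implicit Types (e : rel T) (S : seq T).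

Definition sq e : rel T :=
  fun u v => (u != v) && (e u v || [exists m, e u m && e m v]).

Definition deg e x := #|[set y | e x y]|.

Definition nocycle k e := forall c, ucycle e c -> size c != k.

(** The trace of planarity used for colouring.  Vertices of degree two are not
    counted, so that suppressing them does no harm ([sparse_suppress]). *)
Definition sparse e := forall e' : rel T, symmetric e' -> subrel e' e ->
  (exists x y, e' x y) -> (forall x, deg e' x != 1) ->
  exists c, [/\ ucycle e' c, 2 < size c &
                count (fun x => deg e' x == 3) c <= 5].

Record good e : Prop := Good {
  good_sym : symmetric e;
  good_irrefl : irreflexive e;
  good_deg : forall x, deg e x <= 3;
  good_no4 : nocycle 4 e;
  good_no5 : nocycle 5 e;
  good_sparse : sparse e }.

Lemma sub_ucycle e e' c : subrel e' e -> ucycle e' c -> ucycle e c.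
Proof. by move=> se /andP[/(sub_cycle se) ec uc]; apply/andP. Qed.

Lemma leq_deg e e' x : subrel e' e -> deg e' x <= deg e x.
Proof. by move=> se; apply/subset_leq_card/subsetP => y; rewrite !inE => /se. Qed.

Lemma good_sub e e' : good e -> symmetric e' -> subrel e' e -> good e'.
Proof.
case=> es ei ed e4 e5 esp e's se; split=> //.
- by move=> x; apply/negP => /se; rewrite ei.
- by move=> x; apply: leq_trans (leq_deg x se) (ed x).
- by move=> c /(sub_ucycle se)/e4.
- by move=> c /(sub_ucycle se)/e5.
- by move=> e'' e''s se'' ne d1; apply: (esp e'' e''s) => // x y /se''/se.
Qed.

Definition nedges e := #|[set p : T * T | e p.1 p.2]|.

(** The vertices of [S] are isolated, not removed: the vertex type stays. *)
Definition del S e : rel T := fun u v => [&& e u v, u \notin S & v \notin S].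

Lemma del_sub S e : subrel (del S e) e.
Proof. by move=> u v /and3P[]. Qed.

Lemma del_sym S e : symmetric e -> symmetric (del S e).
Proof. by move=> es u v; rewrite /del es; case: (e v u) => //=; rewrite andbC. Qed.

Lemma nedges_lt e e' x y : subrel e' e -> e x y -> ~~ e' x y -> nedges e' < nedges e.
Proof.
move=> se xy nxy; apply: proper_card; apply/properP; split.
  by apply/subsetP => p; rewrite !inE => /se.
by exists (x, y); rewrite !inE.
Qed.

Lemma sq_sym e : symmetric e -> symmetric (sq e).
Proof.
move=> es u v; rewrite /sq eq_sym es; congr (_ && (_ || _)).
by apply/existsP/existsP => -[m /andP[um mv]]; exists m; rewrite es mv es um.
Qed.

Definition nbs e x (s : seq T) := forall y, e x y -> y \in s.

Section Good.
Variable e : rel T.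
Hypothesis ge : good e.
Let es := good_sym ge.
Let ei := good_irrefl ge.
Let ed := good_deg ge.

Lemma adj_neq x y : e x y -> x != y.
Proof. by apply: contraTneq => ->; rewrite ei. Qed.

Lemma good_n4 a b c d : a != c -> b != d -> e a b -> e b c -> e c d -> ~~ e d a.
Proof.
move=> ac bd ab bc cd; apply/negP => da.
suff /(good_no4 ge) : ucycle e [:: a; b; c; d] by [].
rewrite /ucycle /= ab bc cd da /= !inE !negb_or bd ac.
by rewrite (adj_neq ab) (adj_neq bc) (adj_neq cd) eq_sym (adj_neq da).
Qed.

Lemma good_n5 a b c d f :
  a != c -> a != d -> b != d -> b != f -> c != f ->
  e a b -> e b c -> e c d -> e d f -> ~~ e f a.
Proof.
move=> ac ad bd bf cf ab bc cd df; apply/negP => fa.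
suff /(good_no5 ge) : ucycle e [:: a; b; c; d; f] by [].
rewrite /ucycle /= ab bc cd df fa /= !inE !negb_or ac ad bd bf cf.
by rewrite (adj_neq ab) (adj_neq bc) (adj_neq cd) (adj_neq df) eq_sym (adj_neq fa).
Qed.

(** An edge between the ends would close a 4-cycle, a common neighbour a
    5-cycle. *)
Lemma path3_far a b c d : a != c -> a != d -> b != d -> ~~ e a c -> ~~ e b d ->
  e a b -> e b c -> e c d -> ~~ sq e a d.
Proof.
move=> ac ad bd nac nbd ab bc cd; rewrite /sq ad /= negb_or; apply/andP; split.
  by rewrite es; apply: good_n4 bd ab bc cd.
apply/existsPn => m; apply/negP => /andP[am md].
have mb : m != b by apply: contraTneq md => ->.
have mc : m != c by apply: contraTneq am => ->.
have := @good_n5 a b c d m ac ad bd _ _ ab bc cd; rewrite ![_ == m]eq_sym mb mc.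
by rewrite es md => /(_ isT isT isT)/negP[]; rewrite es.
Qed.

(** The chord closes a 5-cycle with the four other edges. *)
Lemma hexagon_chord a b c d f g : ucycle e [:: a; b; c; d; f; g] -> ~~ e a c.
Proof.
rewrite /ucycle /= !inE !negb_or -!andbA /= ?andbT.
case/and5P=> ab bc cd df /and5P[fg ga nab nac /and5P[nad naf nag nbc]].
case/and5P=> nbd nbf nbg ncd /and5P[ncf ncg ndf ndg nfg].
by apply/negP => ac'; have := good_n5 nad naf ncf ncg ndg ac' cd df fg; rewrite ga.
Qed.

Lemma hexagon_opposite a b c d f g :
  ucycle e [:: a; b; c; d; f; g] -> ~~ sq e a d.
Proof.
move=> H; have nac := hexagon_chord H.
have nbd : ~~ e b d by apply: (@hexagon_chord b c d f g a); rewrite -(rot_ucycle 1) in H.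
move: H; rewrite /ucycle /= !inE !negb_or => /andP[/and4P[ab bc cd _]].
by case/and3P=> /and5P[_ ? ? _ _] /and4P[_ ? _ _] _; apply: path3_far nac nbd ab bc cd.
Qed.

Lemma nb2 x p : e x p -> exists a b, nbs e x [:: p; a; b].
Proof.
move=> xp; have : #|[set y | e x y] :\ p| <= 2.
  by have := ed x; rewrite /deg (cardsD1 p) inE xp.
rewrite cardE => sz; set s := enum _ in sz.
exists (nth p s 0), (nth p s 1) => y xy; rewrite !inE.
case: eqP => //= /eqP yp; have : y \in s by rewrite mem_enum !inE yp.
case: s sz => [|a [|b [|]]] //= _; rewrite !inE; first by move->.
by [].
Qed.

Lemma nb3 x p q : e x p -> e x q -> p != q -> exists r, nbs e x [:: p; q; r].
Proof.
move=> xp xq pq; have [a [b nx]] := nb2 xp.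
have := nx _ xq; rewrite !inE eq_sym (negPf pq) /= => /orP[/eqP qa|/eqP qb].
  by exists b; rewrite qa.
exists a => y /nx; rewrite qb !inE => /or3P[]-> //; rewrite ?orbT //.
Qed.

Lemma nb_full x p q r : e x p -> e x q -> e x r -> uniq [:: p; q; r] ->
  nbs e x [:: p; q; r].
Proof.
move=> xp xq xr; rewrite /= !inE negb_or andbT => /andP[/andP[pq pr] qr].
have [r' nx] := nb3 xp xq pq; have := nx _ xr.
rewrite !inE ![r == _]eq_sym (negPf pr) (negPf qr) /= eq_sym.
by move=> /eqP->.
Qed.

(** When [x] has degree two, [r] is a dummy; hence the condition on [r] before
    its neighbours are named. *)
Lemma third x p q : e x p -> e x q -> p != q -> exists r a b,
  nbs e x [:: p; q; r] /\ (e x r -> nbs e r [:: x; a; b]).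
Proof.
move=> xp xq pq; have [r nx] := nb3 xp xq pq; exists r.
case xr: (e x r); last by exists x, x.
have [|a [b nr]] := @nb2 r x; first by rewrite es.
by exists a, b.
Qed.

Lemma sq_cover x p q r P Q R y : nbs e x [:: p; q; r] ->
  (e x p -> nbs e p P) -> (e x q -> nbs e q Q) -> (e x r -> nbs e r R) ->
  sq e x y -> y \in [:: p; q; r] ++ P ++ Q ++ R.
Proof.
move=> nx np nq nr /andP[_ /orP[/nx|/existsP[m /andP[xm my]]]].
  by rewrite mem_cat => ->.
rewrite !mem_cat; move: (nx m xm); rewrite !inE => /or3P[] /eqP mE; subst m.
- by rewrite (np xm _ my) !orbT.
- by rewrite (nq xm _ my) !orbT.
- by rewrite (nr xm _ my) !orbT.
Qed.

Lemma del_good S : good (del S e).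
Proof. exact: good_sub ge (del_sym S es) (@del_sub S e). Qed.

Lemma del_nedges S x y : x \in S -> e x y -> nedges (del S e) < nedges e.
Proof.
by move=> xS xy; apply: (nedges_lt (@del_sub S e) xy); rewrite /del xS andbF.
Qed.

(** A vertex of [S] has at most one neighbour outside [S], so that no path of
    length two between outer vertices is destroyed. *)
Lemma del_sq S u v : 
  (forall m, m \in S -> exists p q r, [/\ nbs e m [:: p; q; r], p \in S & q \in S]) ->
  u \notin S -> v \notin S -> sq e u v -> sq (del S e) u v.
Proof.
move=> HS uS vS /andP[uv]; rewrite /sq uv /= => /orP[uv'|/existsP[m /andP[um mv]]].
  by rewrite /del uv' uS vS.
have [mS|mS] := boolP (m \in S); last first.
  by apply/orP; right; apply/existsP; exists m; rewrite /del um mv uS vS mS.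
have [p [q [r [nm pS qS]]]] := HS m mS; case/negP: uv; rewrite es in um.
move: (nm _ um) (nm _ mv); rewrite !inE.
case: eqP => [uE|_]; first by rewrite uE pS in uS.
case: eqP => [uE|_]; first by rewrite uE qS in uS.
case: (eqVneq v p) => [vE|_]; first by rewrite vE pS in vS.
case: (eqVneq v q) => [vE|_]; first by rewrite vE qS in vS.
by move=> /= /eqP-> /eqP->.
Qed.

End Good.
End Relations.

(** * Extending a colouring of the square *)

Section Colour.
Variables (T : finType) (C : choiceType) (L : T -> {fset C}).
Hypothesis szL : forall v, #|` L v| = 7.
Implicit Types (e : rel T) (S : seq T) (g : T -> C).

Definition colors g := forall v, g v \in L v.
Definition proper_out S e g :=
  forall u v, u \notin S -> v \notin S -> sq e u v -> g u != g v.
Definition colorable e := exists2 g, colors g & proper_out [::] e g.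

Definition avail e g S v : {fset C} :=
  (L v `\` [fset c in [seq g w | w <- enum T & sq e v w && (w \notin S)]])%fset.

Lemma mem_avail e g S v c : c \in avail e g S v ->
  c \in L v /\ forall w, sq e v w -> w \notin S -> c != g w.
Proof.
case/fsetDP=> cL; rewrite !inE => cN; split=> // w vw wS.
apply: contraNneq cN => ->; apply/mapP; exists w => //.
by rewrite mem_filter vw wS mem_enum.
Qed.

Lemma avail_mem e g S v c : c \in L v ->
  (forall w, sq e v w -> w \notin S -> c != g w) -> c \in avail e g S v.
Proof.
move=> cL cN; apply/fsetDP; split=> //; rewrite !inE.
apply/negP => /mapP[w]; rewrite mem_filter => /andP[/andP[vw wS] _] cw.
by have := cN w vw wS; rewrite cw eqxx.
Qed.

Lemma card_avail e g S F v : (forall w, sq e v w -> w \in S ++ F) ->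
  7 - size F <= #|` avail e g S v|.
Proof.
move=> cov; rewrite leq_subLR -(szL v) -(cardfsID [fset c in [seq g w | w <- F]]%fset (L v)).
apply: leq_add.
  apply: leq_trans (fsubset_leq_card (fsubsetIr _ _)) _.
  apply: leq_trans (leq_imfset_card _ _ _) _.
  by apply: leq_trans (size_undup _) _; rewrite size_map.
apply: fsubset_leq_card; apply/fsetDS/fsubsetP => c; rewrite !inE.
case/mapP=> w; rewrite mem_filter => /andP[/andP[vw wS] _] ->.
by apply: map_f; have := cov w vw; rewrite mem_cat (negPf wS).
Qed.

Lemma avail_gt k e g S F v : (forall w, sq e v w -> w \in S ++ F) ->
  k + size F < 7 -> k < #|` avail e g S v|.
Proof. by move=> /(card_avail g) le lt; apply: leq_trans le; rewrite ltn_subRL addnC. Qed.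

(** The new colours are a list of pairs, read by looking up the first pair of a
    vertex; this way the recoloured vertices need not be known to be distinct. *)
Lemma extend_coloring e g (ps : seq (T * C)) : symmetric e -> colors g ->
  proper_out (unzip1 ps) e g ->
  (forall p, p \in ps -> p.2 \in avail e g (unzip1 ps) p.1) ->
  pairwise (fun p q => sq e p.1 q.1 ==> (p.2 != q.2)) ps ->
  colorable e.
Proof.
move=> es Lg pg pav pps.
pose f v := if v \in unzip1 ps then nth (g v) (unzip2 ps) (index v (unzip1 ps)) else g v.
have fps v : v \in unzip1 ps -> (v, f v) \in ps.
  move=> vps; rewrite /f vps; have lti : index v (unzip1 ps) < size ps.
    by rewrite -(size_map fst) index_mem.
  rewrite (nth_map (v, g v)) //.
  suff <- : nth (v, g v) ps (index v (unzip1 ps)) = 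
    (v, (nth (v, g v) ps (index v (unzip1 ps))).2) by apply: mem_nth.
  have := nth_index v vps; rewrite (nth_map (v, g v)) //.
  by case: (nth _ _ _) => a b /= ->.
have fout v : v \notin unzip1 ps -> f v = g v by rewrite /f => /negPf ->.
exists f => [v|u v _ _ uv].
  have [/fps/pav/mem_avail[]//|/fout->//] := boolP (v \in unzip1 ps).
have [ups|ups] := boolP (u \in unzip1 ps); have [vps|vps] := boolP (v \in unzip1 ps).
- have R (p q : T * C) : p \in ps -> q \in ps -> sq e p.1 q.1 -> p.2 != q.2.
    have sqC := sq_sym es.
    have : all2rel (fun p q => sq e p.1 q.1 ==> (p.2 != q.2)) ps.
      rewrite -pairwise_all2rel // => [p'|p' q'].
        by rewrite /sq eqxx.
      by rewrite sqC eq_sym.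
    by move=> /allrelP H pp pq pqs; move: (H p q pp pq); rewrite pqs.
  exact: (R _ _ (fps _ ups) (fps _ vps)).
- by rewrite (fout _ vps); have [_] := mem_avail (pav _ (fps _ ups)); apply.
- rewrite (fout _ ups) eq_sym; have [_] := mem_avail (pav _ (fps _ vps)); apply=> //.
  by rewrite sq_sym.
- by rewrite (fout _ vps) (fout _ ups); apply: pg.
Qed.

End Colour.

(** * Vertices of degree one or two in a smallest counterexample *)

Ltac sub_lists := apply/allP; rewrite /= !inE !eqxx /= ?orbT //=.

Section Reductions.
Variables (T : finType) (C : choiceType) (L : T -> {fset C}).
Hypothesis szL : forall v, #|` L v| = 7.
Variable e : rel T.
Hypothesis ge : good e.
Hypothesis IH : forall e', good e' -> nedges e' < nedges e -> colorable L e'.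
Hypothesis ncol : ~ colorable L e.
Let es := good_sym ge.
Let ei := good_irrefl ge.
Let ed := good_deg ge.

(** A vertex with at most six neighbours in the square can be coloured last. *)
Lemma recolor_vertex v e' F : good e' -> nedges e' < nedges e ->
  (forall u w, u != v -> w != v -> sq e u w -> sq e' u w) ->
  (forall w, sq e v w -> w \in v :: F) -> size F <= 6 -> False.
Proof.
move=> ge' lt sub cov sF; apply: ncol; have [g Lg pg] := IH ge' lt.
have [c cA _] : exists2 c, c \in avail L e g [:: v] v & c \notin [::].
  by apply: pick_avoid; apply: (@avail_gt _ _ _ szL 0 e g [:: v] F v cov sF).
apply: (@extend_coloring _ _ _ _ g [:: (v, c)]) => //= [u w|p].
  by rewrite !inE => uv wv /(sub _ _ uv wv); apply: pg.
by rewrite inE => /eqP->.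
Qed.

Lemma deg_min x : deg e x != 1.
Proof.
apply/negP; rewrite /deg => /cards1P[u xuE].
have nx y : e x y = (y == u) by rewrite -in_set1 -xuE inE.
have xu : e x u by rewrite nx.
have [|a [b nu]] := @nb2 _ _ ge u x; first by rewrite es.
apply: (@recolor_vertex x (del [:: x] e) [:: u; a; b]) => //.
- exact: del_good.
- by apply: del_nedges xu; rewrite inE.
- move=> s t sx tx; rewrite /sq => /andP[st]; rewrite st /= => /orP[stE|/existsP[m /andP[sm mt]]].
    by rewrite /del stE !inE sx tx.
  apply/orP; right; apply/existsP; exists m; rewrite /del sm mt !inE sx tx.
  suff -> : m != x by [].
  apply: contraNneq st => mx; subst m.
  by move: sm mt; rewrite es !nx => /eqP-> /eqP->.
move=> w /andP[_ /orP[|/existsP[m /andP[]]]].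
  by rewrite nx => /eqP->; rewrite !inE eqxx orbT.
rewrite nx => /eqP-> /nu; rewrite !inE => /or3P[]->; rewrite ?orbT //.
Qed.

Lemma deg2_nbs x : deg e x = 2 -> exists u w, [/\ u != w, e x u, e x w & nbs e x [:: u; w]].
Proof.
move=> dx; have /cards2P[u [w [uw xE]]] : #|[set y | e x y]| == 2 by rewrite -/(deg e x) dx.
exists u, w.
have nx y : e x y = (y \in [:: u; w]) by move/setP/(_ y): xE; rewrite !inE.
by split=> //; [rewrite nx !inE eqxx|rewrite nx !inE eqxx orbT|move=> y; rewrite nx].
Qed.

Section TwoVertex.
Variables (v u w : T).
Hypotheses (uw : u != w) (vu : e v u) (vw : e v w) (nv : nbs e v [:: u; w]).

Let uv : e u v. Proof. by rewrite es. Qed.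
Let wv : e w v. Proof. by rewrite es. Qed.
Let nv3 : nbs e v [:: u; w; u].
Proof. by move=> y /nv; rewrite !inE => /orP[]->; rewrite ?orbT. Qed.

(** The pair of the two neighbours of [v] is the only one that deleting [v] can
    push to distance more than two. *)
Lemma two_vertex_sq s t : s != v -> t != v -> sq e s t ->
  sq (del [:: v] e) s t \/ (s == u) && (t == w) || (s == w) && (t == u).
Proof.
move=> sv tv; rewrite /sq => /andP[st]; rewrite st /= => /orP[stE|/existsP[m /andP[sm mt]]].
  by left; rewrite /del stE !inE sv tv.
have [mv|mv] := eqVneq m v; last first.
  left; apply/orP; right; apply/existsP; exists m.
  by rewrite /del sm mt !inE sv tv mv.
right; move: sm mt st; rewrite mv es => /nv sE /nv; move: sE; rewrite !inE.
by case/orP=> /eqP->; case/orP=> /eqP->; rewrite ?eqxx // orbT.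
Qed.

(** If the neighbours of [v] are adjacent, deleting [v] loses no constraint
    between other vertices. *)
Lemma two_vertex_triangle : ~~ e u w.
Proof.
apply/negP => euw; have ewu : e w u by rewrite es.
have uvw : v != w by apply: (adj_neq ge).
have uvu : v != u by apply: (adj_neq ge).
have [a nu] := nb3 ge uv euw uvw.
have [b nw] := nb3 ge wv ewu uvu.
apply: (@recolor_vertex v (del [:: v] e) [:: u; w; a; b]) => //.
- exact: del_good.
- by apply: del_nedges vu; rewrite inE.
- move=> s t sv tv /(two_vertex_sq sv tv)[//|].
  have uwsq : sq (del [:: v] e) u w.
    by rewrite /sq uw /del euw !inE ![_ == v]eq_sym uvu uvw.
  by case/orP=> /andP[/eqP-> /eqP->] //; rewrite sq_sym //; apply: del_sym.
move=> y /(sq_cover nv3 (fun=> nu) (fun=> nw) (fun=> nu)).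
by move: y; sub_lists.
Qed.

(** Colour the graph without [v].  If the neighbours [u] and [w] get different
    colours, [v] can be coloured last.  If they agree, the colouring of the rest
    of the hexagon is the one from which [hexagon_recolor] starts. *)
Lemma two_vertex_hexagon a b c : ~ ucycle e [:: v; u; a; b; c; w].
Proof.
move=> H.
have Hrot k : ucycle e (rot k [:: v; u; a; b; c; w]) by rewrite rot_ucycle.
have [o1 o2 o3] : [/\ ~~ sq e v b, ~~ sq e u c & ~~ sq e a w].
  split; [exact: hexagon_opposite H|exact: hexagon_opposite (Hrot 1)|].
  exact: hexagon_opposite (Hrot 2).
have := H; rewrite /ucycle /= !inE !negb_or -!andbA /= ?andbT.
case/and5P=> _ ua ab bc /and5P[cw _ nvu nva /and5P[nvb nvc nvw nua]].
case/and5P=> nub nuc _ nab /and5P[nac naw nbc nbw ncw].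
have [[au ba cb wc] [unv anv bnv cnv wnv] [anu bna cnb]] :
  [/\ [/\ e a u, e b a, e c b & e w c], [/\ u != v, a != v, b != v, c != v & w != v] &
  [/\ a != u, b != a & c != b]].
  by split; split; (rewrite es || rewrite eq_sym).
have [r1 [a1 [b1 [n1 m1]]]] := third ge uv ua nva.
have [r2 [a2 [b2 [n2 m2]]]] := third ge au ab nub.
have [r3 [a3 [b3 [n3 m3]]]] := third ge ba bc nac.
have [r4 [a4 [b4 [n4 m4]]]] := third ge cb cw nbw.
have [r5 [a5 [b5 [n5 m5]]]] := third ge wv wc nvc.
pose S := [:: v; u; a; b; c; w].
have gd : good (del [:: v] e) by exact: del_good.
have [|g Lg pg] := IH gd; first by apply: del_nedges vu; rewrite inE.
have dadj s t : s != v -> t != v -> e s t -> g s != g t.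
  by move=> sv tv st; apply: pg => //; rewrite /sq /del st !inE sv tv (adj_neq ge st).
have dadj2 s m t : s != v -> t != v -> m != v -> s != t -> e s m -> e m t -> g s != g t.
  move=> sv tv mv st sm mt; apply: pg => //; rewrite /sq st; apply/orP; right.
  by apply/existsP; exists m; rewrite /del sm mt !inE sv tv mv.
have cov0 y : sq e v y -> y \in S ++ [:: r1; r5].
  move/(sq_cover nv3 (fun=> n1) (fun=> n5) (fun=> n1)); move: y; sub_lists.
(* Agreement of these two colours is the only obstruction to colouring [v]. *)
have [guw|guw] := eqVneq (g u) (g w); last first.
  have cov y : sq e v y -> y \in [:: v] ++ [:: u; w; a; r1; c; r5].
    move/(sq_cover nv3 (fun=> n1) (fun=> n5) (fun=> n1)); move: y; sub_lists.
  have [k kA _] : exists2 k, k \in avail L e g [:: v] v & k \notin [::].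
    by apply: pick_avoid; apply: (avail_gt szL g cov).
  apply: ncol; apply: (@extend_coloring _ _ _ _ g [:: (v, k)]) => //= [s t|p].
    rewrite !inE => sv tv /(two_vertex_sq sv tv)[/pg->//|].
    by case/orP=> /andP[/eqP-> /eqP->] //; rewrite eq_sym.
  by rewrite inE => /eqP->.
have out s t : s != v -> sq e s t -> t \notin S -> g s != g t.
  move=> sv st tS; have [tv tu tw] : [/\ t != v, t != u & t != w].
    by move: tS; rewrite !inE !negb_or => /and5P[-> -> _ _ /andP[_ ->]].
  by case: (two_vertex_sq sv tv st) => [/pg->//|]; rewrite (negPf tu) (negPf tw) !andbF.
have gav s : s != v -> g s \in avail L e g S s.
  by move=> sv; apply: avail_mem => // t; apply: out.
have cov1 y : sq e u y -> y \in S ++ [:: r1; a1; b1; r2].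
  move/(sq_cover n1 (fun=> nv) (fun=> n2) m1); move: y; sub_lists.
have cov2 y : sq e a y -> y \in S ++ [:: r2; a2; b2; r1; r3].
  move/(sq_cover n2 (fun=> n1) (fun=> n3) m2); move: y; sub_lists.
have cov3 y : sq e b y -> y \in S ++ [:: r3; a3; b3; r2; r4].
  move/(sq_cover n3 (fun=> n2) (fun=> n4) m3); move: y; sub_lists.
have cov4 y : sq e c y -> y \in S ++ [:: r4; a4; b4; r3; r5].
  move/(sq_cover n4 (fun=> n3) (fun=> n5) m4); move: y; sub_lists.
have cov5 y : sq e w y -> y \in S ++ [:: r5; a5; b5; r4].
  move/(sq_cover n5 (fun=> nv) (fun=> n4) m5); move: y; sub_lists.
have s1 : 2 < #|` avail L e g S u| by apply: (avail_gt szL g cov1).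
have s2 : 1 < #|` avail L e g S a| by apply: (avail_gt szL g cov2).
have s3 : 1 < #|` avail L e g S b| by apply: (avail_gt szL g cov3).
have s4 : 1 < #|` avail L e g S c| by apply: (avail_gt szL g cov4).
have s5 : 2 < #|` avail L e g S w| by apply: (avail_gt szL g cov5).
have s0 : 4 < #|` avail L e g S v| by apply: (avail_gt szL g cov0).
have guc : g u \in avail L e g S w by rewrite guw; apply: gav.
have ucol : uniq [:: g u; g a; g b; g c].
  rewrite /= !inE !negb_or andbT -!andbA.
  rewrite (dadj u a) // (dadj2 u a b) // (dadj a b) // (dadj2 a b c) // (dadj b c) //.
  by rewrite guw (dadj w c).
have [c1 [c2 [c3 [c4 [c5 [[c1A c2A c3A c4A c5A] [c12 c13 c23 c24 [c34 c35 c45 c15]]]]]]]] :=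
  hexagon_recolor s1 s2 s3 s4 s5 (gav _ anv) (gav _ bnv) (gav _ cnv) (gav _ unv) guc ucol.
have [c0 c0A] := @pick_avoid _ _ [:: c1; c2; c4; c5] s0.
rewrite !inE !negb_or => /and4P[c01 c02 c04 c05].
apply: ncol; apply: (@extend_coloring _ _ _ _ g
  [:: (v, c0); (u, c1); (a, c2); (b, c3); (c, c4); (w, c5)]) => //=.
- move=> s t sS tS /[dup] st /out; apply => //.
  by move: sS; rewrite inE negb_or => /andP[].
- apply/(@allP _ (fun p => p.2 \in avail L e g S p.1)) => /=.
  by rewrite c0A c1A c2A c3A c4A c5A.
rewrite c01 c02 c04 c05 c12 c13 c23 c24 c34 c35 c45 c15 !implybT /=.
by rewrite (negPf o1) (negPf o2) (negPf o3).
Qed.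

End TwoVertex.
End Reductions.

(** * Suppressing a vertex of degree two *)

Section Suppression.
Variable T : finType.
Implicit Types (e : rel T) (u v w x y : T) (c s : seq T).

Definition is_pair u w x y := (x == u) && (y == w) || (x == w) && (y == u).

Lemma is_pairC u w x y : is_pair u w x y = is_pair w u x y.
Proof. by rewrite /is_pair orbC. Qed.

Lemma is_pair_sym u w x y : is_pair u w x y = is_pair u w y x.
Proof. by rewrite /is_pair orbC andbC [X in _ || X]andbC. Qed.

Definition suppress v u w e : rel T := fun x y => del [:: v] e x y || is_pair u w x y.

Definition subdivide v u w e : rel T := fun x y =>
  [|| e x y && ~~ is_pair u w x y, is_pair v u x y | is_pair v w x y].

Lemma suppress_neq e v u w x y : u != v -> w != v -> suppress v u w e x y ->
  (x != v) && (y != v).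
Proof.
move=> uv wv /orP[/and3P[_]|]; first by rewrite !inE => -> ->.
by case/orP=> /andP[/eqP-> /eqP->]; rewrite uv wv.
Qed.

(** The cycle lengthens by one when the new edge is replaced by the path
    through [v]. *)
Lemma cycle_through e v u w c : u != v -> w != v ->
  ucycle (suppress v u w e) c -> 2 < size c -> e w v -> e v u ->
  w \in c -> next c w = u -> exists2 s, ucycle e (w :: v :: u :: s) & size c = (size s).+2.
Proof.
move=> uv' wv' cc sc wv vu wc nwu; have [i s rc] := rot_to wc.
have : ucycle (suppress v u w e) (w :: s) by rewrite -rc rot_ucycle.
have szc : size c = (size s).+1 by rewrite -(size_rot i) rc.
have vs : v \notin w :: s.
  rewrite -rc mem_rot; apply/negP => vc; case/andP: (cc) => /next_cycle/(_ vc).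
  by move/(suppress_neq uv' wv'); rewrite eqxx.
have : next (w :: s) w = u by rewrite -rc next_rot //; case/andP: cc.
case: s szc vs {rc} => [|u' [|a s]] /= szc vs; rewrite ?eqxx; [by rewrite szc in sc..|].
move=> uE; rewrite {}uE in vs szc * => /andP[/= /and3P[_ ua pa] uni].
have /and4P[wNs uNs aNs s_uniq] := uni.
have vN x : x \in a :: s -> (x != u) && (x != w).
  move=> xs; rewrite (memPn uNs) //=; apply: (memPn wNs).
  by rewrite inE xs orbT.
have dN x y : x \in a :: s -> suppress v u w e x y -> e x y.
  move=> /vN/andP[xu xw] /orP[/del_sub//|]; rewrite /is_pair (negPf xu) (negPf xw).
  by [].
have dN' x y : y \in a :: s -> suppress v u w e x y -> e x y.
  move=> /vN/andP[xu xw] /orP[/del_sub//|]; rewrite /is_pair (negPf xu) (negPf xw).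
  by rewrite !andbF.
move: pa; rewrite rcons_path => /andP[pa lw].
have dp : path e a s.
  apply: (sub_in_path (P := mem (a :: s))) pa => [x y xs ys|]; first by apply: dN xs.
  exact/allP.
have dl := dN _ _ (mem_last a s) lw.
have du : e u a by apply: dN' ua; rewrite inE eqxx.
exists (a :: s); last by rewrite szc.
rewrite /ucycle /= wv vu du rcons_path dp dl /=.
move: vs; rewrite inE negb_or eq_sym => /andP[wv2 ->]; rewrite uNs aNs s_uniq !andbT.
by rewrite inE negb_or wv2.
Qed.

Lemma suppress_cycle e v u w c : u != v -> w != v ->
  ucycle (suppress v u w e) c -> 2 < size c -> e w v -> e v u -> e u v -> e v w ->
  [\/ ucycle e c, 
      exists2 s, ucycle e (w :: v :: u :: s) & size c = (size s).+2 |
      exists2 s, ucycle e (u :: v :: w :: s) & size c = (size s).+2].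
Proof.
move=> uv' wv' cc sc wv vu uv vw.
case: (boolP ((w \in c) && (next c w == u))) => [/andP[wc /eqP nw]|H1].
  by constructor 2; apply: cycle_through nw.
case: (boolP ((u \in c) && (next c u == w))) => [/andP[uc /eqP nu]|H2].
  constructor 3; apply: cycle_through nu => //.
  case/andP: cc => cc uc'; rewrite /ucycle uc' andbT; apply: sub_cycle cc => x y.
  by rewrite /suppress is_pairC.
constructor 1; case/andP: cc => cc uc; rewrite /ucycle uc andbT.
apply: cycle_from_next => // x xc; have /orP[/del_sub//|] := next_cycle cc xc.
case/orP=> /andP[/eqP xE nE]; subst x; first by rewrite xc nE in H2.
by rewrite xc nE in H1.
Qed.

Lemma eq_deg e e' x : (forall y, e x y = e' x y) -> deg e x = deg e' x.
Proof. by move=> ee; apply: eq_card => y; rewrite !inE ee. Qed.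

Section Subdivide.
Variables (e : rel T) (v u w : T).
Hypotheses (es : symmetric e) (vu : e v u) (vw : e v w).
Hypotheses (uv' : u != v) (wv' : w != v) (uw' : u != w).

Lemma suppress_sym : symmetric (suppress v u w e).
Proof. by move=> x y; rewrite /suppress (del_sym _ es) is_pair_sym. Qed.

Section Sub.
Variable f : rel T.
Hypotheses (fs : symmetric f) (fe : subrel f (suppress v u w e)) (fuw : f u w).
Let f' := subdivide v u w f.

Lemma subdivide_sub : subrel f' e.
Proof.
move=> x y /or3P[/andP[/fe/orP[/del_sub//|->//]]||];
by case/orP=> /andP[/eqP-> /eqP->]; rewrite // es.
Qed.

Lemma subdivide_sym : symmetric f'.
Proof. by move=> x y; rewrite /f' /subdivide fs !(is_pair_sym _ _ x). Qed.

Lemma subdivide_neq x y : x != v -> y != v -> f' x y = f x y && ~~ is_pair u w x y.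
Proof. by move=> xv yv; rewrite /f' /subdivide /is_pair (negPf xv) (negPf yv) !andbF !orbF. Qed.

Lemma f_neq x y : f x y -> (x != v) && (y != v).
Proof. by move/fe/(suppress_neq uv' wv'). Qed.

Lemma deg_subdivide_mid : deg f' v = 2.
Proof.
rewrite -[RHS](_ : #|[set u; w]| = 2); last by rewrite cards2 uw'.
apply: eq_card => y; rewrite !inE /f' /subdivide /is_pair eqxx.
case fvy: (f v y) => /=; first by have := f_neq fvy; rewrite eqxx.
rewrite ![v == _]eq_sym (negPf uv') (negPf wv') /=.
by case: (y == u); case: (y == w).
Qed.

Lemma deg_subdivide_end : deg f' u = deg f u.
Proof.
rewrite [RHS](cardsD1 w) inE fuw -[LHS](_ : #|v |: ([set y | f u y] :\ w)| = _).
  rewrite cardsU1 !inE; case fvy: (f u v) => /=; last by rewrite andbF.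
  by have := f_neq fvy; rewrite eqxx andbF.
apply: eq_card => y; rewrite !inE /f' /subdivide /is_pair eqxx.
rewrite (negPf uv') (negPf uw') /=.
by case: (y == v); case: (y == w); case: (f u y).
Qed.
End Sub.

End Subdivide.

Lemma deg_subdivide e v u w f x : u != v -> w != v -> u != w ->
  symmetric f -> subrel f (suppress v u w e) -> f u w ->
  x != v -> deg (subdivide v u w f) x = deg f x.
Proof.
move=> uv' wv' uw' fs fe fuw xv; have [->|xu] := eqVneq x u.
  exact: (@deg_subdivide_end e).
have [->|xw] := eqVneq x w.
  rewrite -(@deg_subdivide_end e v w u wv' uv' _ f) //; first last.
  - by rewrite fs.
  - by move=> s t /fe; rewrite /suppress is_pairC.
  - by rewrite eq_sym.
  by apply: eq_deg => y; rewrite /subdivide is_pairC [X in _ || X]orbC.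
apply: eq_deg => y; rewrite /subdivide /is_pair (negPf xv) (negPf xu) (negPf xw) /=.
by rewrite andbT orbF.
Qed.

(** A subgraph that uses the new edge is subdivided into a subgraph of [e].  This
    keeps all degrees and gives [v] degree two, which is not counted; a cycle of
    the subdivided graph through [v] shortens to a cycle through the new edge. *)
Lemma sparse_suppress e v u w : symmetric e -> e v u -> e v w -> ~~ e u w ->
  u != v -> w != v -> u != w -> nbs e v [:: u; w] ->
  sparse e -> sparse (suppress v u w e).
Proof.
move=> es vu vw nuw uv' wv' uw' nv spe f fs fe [x0 [y0 xy0]] df.
have [fuw|fuw] := boolP (f u w); last first.
  apply: spe => // [x y /[dup] fxy /fe/orP[/del_sub//|]|]; last by exists x0, y0.
  case/orP=> /andP[/eqP xE /eqP yE]; move: fxy fuw; rewrite xE yE; first by move->.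
  by rewrite fs => ->.
pose f' := subdivide v u w f.
have degE x : x != v -> deg f' x = deg f x by exact: (@deg_subdivide e).
have [|||x|c [cc sc hc]] := spe f'.
- exact: subdivide_sym.
- exact: subdivide_sub.
- by exists v, u; rewrite /f' /subdivide /is_pair !eqxx !orbT.
- have [->|xv] := eqVneq x v; last by rewrite degE.
  by rewrite (@deg_subdivide_mid e).
have f'E x y : x != v -> y != v -> f' x y = f x y && ~~ is_pair u w x y.
  exact: (@subdivide_neq v u w f).
have cntE s : v \notin s -> count (fun x => deg f' x == 3) s = count (fun x => deg f x == 3) s.
  by move=> vs; apply: eq_in_count => x xs; rewrite degE //; apply: contraNneq vs => <-.
have [vc|vc] := boolP (v \in c); last first.
  exists c; rewrite -(cntE c vc); split=> //.
  case/andP: cc => cc uc; rewrite /ucycle uc andbT.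
  have := @sub_in_cycle _ (mem c) f' f.
  move=> /(_ _ c _ cc); apply; last exact/allP.
  move=> x y xc yc; rewrite f'E; [by case/andP|..]; by apply: contraNneq vc => <-.
have [i s rc] := rot_to vc.
have szc : size c = (size s).+1 by rewrite -(size_rot i) rc.
have : ucycle f' (v :: s) by rewrite -rc rot_ucycle.
rewrite /ucycle /= => /andP[ps /andP[vs us]].
have hs : count (fun x => deg f x == 3) s <= 5.
  rewrite -(cntE s vs); apply: leq_trans hc.
  have /permP <- : perm_eq (v :: s) c by rewrite -rc perm_rot.
  by rewrite /= leq_addl.
case: s szc ps vs us hs {rc} => [|a s] szc; first by rewrite szc in sc.
rewrite /= rcons_path => /and3P[va pas lv] vs /andP[aNs us] hs.
have f'e : subrel f' e by exact: subdivide_sub.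
have sN x : x \in a :: s -> x != v by move=> xs; apply: contraNneq vs => <-.
have pfas : path f a s.
  have := @sub_in_path _ (mem (a :: s)) f' f; apply; last exact: pas; last exact/allP.
  by move=> x y xs ys; rewrite f'E ?sN // => /andP[].
have s0 : s != [::] by case: (s) szc sc => [->|].
have las : last a s \in s by case: (s) s0 => //= b s' _; rewrite mem_last.
have lNa : last a s != a by apply: contraNneq aNs => <-.
have plas : is_pair u w a (last a s).
  have := nv _ (f'e _ _ va); have : e v (last a s) by rewrite es; apply: f'e.
  move=> /nv; rewrite /is_pair !inE; case/orP=> /eqP lE; case/orP=> /eqP aE;
    by move: lNa; rewrite lE aE ?eqxx ?orbT.
exists (a :: s); split => //.
  rewrite /ucycle /= rcons_path pfas aNs us /= andbT.
  by case/orP: plas => /andP[/eqP-> /eqP->] //; rewrite fs.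
case: s {vs hs us szc aNs las lNa pfas} s0 pas plas lv sN => [|b [|d s]] //= _.
rewrite andbT => ab pab _ sN.
by move: ab; rewrite f'E ?pab ?andbF // sN // !inE eqxx ?orbT.
Qed.

End Suppression.

Section Reductions2.
Variables (T : finType) (C : choiceType) (L : T -> {fset C}).
Hypothesis szL : forall v, #|` L v| = 7.
Variable e : rel T.
Hypothesis ge : good e.
Hypothesis IH : forall e', good e' -> nedges e' < nedges e -> colorable L e'.
Hypothesis ncol : ~ colorable L e.
Let es := good_sym ge.
Let ei := good_irrefl ge.
Let ed := good_deg ge.

Section TwoVertex.
Variables (v u w : T).
Hypotheses (uw : u != w) (vu : e v u) (vw : e v w) (nv : nbs e v [:: u; w]).

Let uv : e u v. Proof. by rewrite es. Qed.
Let wv : e w v. Proof. by rewrite es. Qed.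
Let uv' : u != v. Proof. exact: (adj_neq ge). Qed.
Let wv' : w != v. Proof. exact: (adj_neq ge). Qed.
Let wu : w != u. Proof. by rewrite eq_sym. Qed.
Let nv' : nbs e v [:: w; u].
Proof. by move=> y /nv; rewrite !inE orbC. Qed.

Let e' := suppress v u w e.

(** A 4-cycle or 5-cycle through the new edge comes from a 5-cycle or 6-cycle
    through [v]; the latter is excluded by [two_vertex_hexagon]. *)
Lemma good_suppress : good e'.
Proof.
have nuw := two_vertex_triangle szL ge IH ncol uw vu vw nv.
have e's : symmetric e' by exact: suppress_sym.
have e'uw : e' u w by rewrite /e' /suppress /is_pair !eqxx orbT.
split=> //.
- move=> x; rewrite /e' /suppress /del ei /is_pair /=.
  apply/negP => /orP[] /andP[/eqP-> /eqP xE]; move: uw; rewrite xE eqxx //.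
- move=> x; have [->|xv] := eqVneq x v.
    rewrite /deg eq_card0 // => y; rewrite !inE; apply/negP.
    by move/(suppress_neq uv' wv'); rewrite eqxx.
  rewrite -(@deg_subdivide T e v u w e' x) //.
  by apply: leq_trans (ed x); apply: leq_deg; apply: subdivide_sub.
- move=> c cc; apply/negP => /eqP sc.
  have [|ce|[s cs]|[s cs]] := suppress_cycle uv' wv' cc _ wv vu uv vw.
  + by rewrite sc.
  + by have := good_no4 ge ce; rewrite sc.
  + by rewrite sc => -[ss]; have := good_no5 ge cs; rewrite /= -ss.
  + by rewrite sc => -[ss]; have := good_no5 ge cs; rewrite /= -ss.
- move=> c cc; apply/negP => /eqP sc.
  have [|ce|[s cs]|[s cs]] := suppress_cycle uv' wv' cc _ wv vu uv vw.
  + by rewrite sc.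
  + by have := good_no5 ge ce; rewrite sc.
  + rewrite sc => -[]; case: s cs => [|a [|b [|c' [|]]]] // cs _.
    apply: (@two_vertex_hexagon _ _ _ szL _ ge IH ncol v u w vu vw nv a b c').
    by move: cs; rewrite -(rot_ucycle 1).
  + rewrite sc => -[]; case: s cs => [|a [|b [|c' [|]]]] // cs _.
    apply: (@two_vertex_hexagon _ _ _ szL _ ge IH ncol v w u vw vu nv' a b c').
    by move: cs; rewrite -(rot_ucycle 1).
- by apply: sparse_suppress => //; apply: good_sparse.
Qed.

(** The neighbours of [v] are adjacent once [v] is suppressed, hence coloured
    differently, and [v] sees at most six vertices in the square. *)
Lemma no_two_vertex : False.
Proof.
have [a [b nu]] := nb2 ge uv; have [a' [b' nw]] := nb2 ge wv.
apply: (@recolor_vertex _ _ _ szL _ ge IH ncol v e' [:: u; w; a; b; a'; b']) => //.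
- exact: good_suppress.
- pose E (f : rel T) := [set p : T * T | f p.1 p.2].
  pose R := E e :\ (u, v) :\ (v, u) :\ (w, v) :\ (v, w).
  have cE : #|E e| = #|R|.+4.
    rewrite (cardsD1 (u, v)) (cardsD1 (v, u)) (cardsD1 (w, v)) (cardsD1 (v, w)).
    rewrite !inE /= !xpair_eqE vu uv vw wv !eqxx /=.
    by rewrite ?[v == _]eq_sym (negPf uv') (negPf wv') (negPf wu) ?andbF.
  apply: (@leq_ltn_trans #|R|.+2); last by rewrite /nedges -/(E e) cE.
  apply: (@leq_trans #|(u, w) |: ((w, u) |: R)|); last first.
    by rewrite !cardsU1 -(add1n _.+1) -(add1n #|R|) !leq_add ?leq_b1.
  apply/subset_leq_card/subsetP => -[x y]; rewrite !inE /= !xpair_eqE.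
  case/orP=> [/and3P[-> xv yv]|/orP[]/andP[-> ->]]; rewrite ?orbT //.
  by move: xv yv; rewrite !inE => /negPf-> /negPf->; rewrite ?andbF ?orbT.
- move=> s t sv tv /(two_vertex_sq ge nv sv tv)[].
    case/andP=> st h; rewrite /sq st /=; case/orP: h => [h|/existsP[m /andP[sm mt]]].
      by rewrite /e' /suppress h.
    by apply/orP; right; apply/existsP; exists m; rewrite /e' /suppress sm mt.
  by case/orP=> /andP[/eqP-> /eqP->]; rewrite /sq /e' /suppress /is_pair ?uw ?wu !eqxx ?orbT.
have nv3 : nbs e v [:: u; w; u].
  by move=> y /nv; rewrite !inE => /orP[]->; rewrite ?orbT.
move=> y /(sq_cover nv3 (fun=> nu) (fun=> nw) (fun=> nu)).
by move: y; sub_lists.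
Qed.
End TwoVertex.

Lemma degE x y : e x y -> deg e x = 3.
Proof.
move=> xy; have := deg_min szL ge IH ncol x.
have : deg e x != 2.
  by apply/eqP => /deg2_nbs[u [w [uw xu xw nx]]]; apply: no_two_vertex nx.
have : 0 < deg e x by apply/card_gt0P; exists y; rewrite inE.
by have := ed x; case: (deg e x) => [|[|[|[|]]]].
Qed.

Lemma nbsE x y : e x y -> exists p q, [/\ uniq [:: y; p; q], e x p, e x q & nbs e x [:: y; p; q]].
Proof.
move=> xy; have := degE xy; rewrite /deg (cardsD1 y) inE xy => -[] /eqP.
case/cards2P=> p [q [pq xE]]; have /setP xE' := xE.
have := xE' p; have := xE' q; have := xE' y; rewrite !inE !eqxx xy /= ?orbT => yE.
move=> /andP[qy xq] /andP[py xp]; exists p, q; split=> //.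
  by rewrite /= !inE negb_or !andbT ![y == _]eq_sym qy py pq.
apply: nb_full => //.
by rewrite /= !inE negb_or !andbT ![y == _]eq_sym qy py pq.
Qed.

End Reductions2.

(** * Configurations with triangles *)

Section Triangles.
Variables (T : finType) (C : choiceType) (L : T -> {fset C}).
Hypothesis szL : forall v, #|` L v| = 7.
Variable e : rel T.
Hypothesis ge : good e.
Hypothesis IH : forall e', good e' -> nedges e' < nedges e -> colorable L e'.
Hypothesis ncol : ~ colorable L e.
Let es := good_sym ge.
Let ei := good_irrefl ge.
Let ed := good_deg ge.

Lemma del_color S x y : x \in S -> e x y ->
  (forall m, m \in S -> exists p q r, [/\ nbs e m [:: p; q; r], p \in S & q \in S]) ->
  exists2 g, colors L g & proper_out S e g.
Proof.
move=> xS xy HS; have [|g Lg pg] := IH (del_good ge S); first exact: del_nedges xy.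
by exists g => // u v uS vS /(del_sq ge HS uS vS); apply: pg.
Qed.

(** The seven vertices are deleted and coloured last.  Without short cycles the
    square has no edges among them beyond those forced by the configuration. *)
Lemma hexagon_triangle c0 c1 z c2 c3 c4 c5 :
  e c0 z -> e c1 z -> ~ ucycle e [:: c0; c1; c2; c3; c4; c5].
Proof.
move=> e0z e1z H.
have Hrot k : ucycle e (rot k [:: c0; c1; c2; c3; c4; c5]) by rewrite rot_ucycle.
have o03 := hexagon_opposite ge H; have o14 := hexagon_opposite ge (Hrot 1).
have o25 := hexagon_opposite ge (Hrot 2).
have n02 := hexagon_chord ge H; have n13 := hexagon_chord ge (Hrot 1).
have n40 := hexagon_chord ge (Hrot 4); have n51 := hexagon_chord ge (Hrot 5).
have := H; rewrite /ucycle /= !inE !negb_or -!andbA /= ?andbT.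
case/and5P=> e01 e12 e23 e34 /and5P[e45 e50 d01 d02].
case/and5P=> d03 d04 d05 d12 /and5P[d13 d14 d15 d23].
case/and5P=> d24 d25 d34 d35 d45.
have [[e10 e21 e32 e43] [e54 e05 ez0 ez1]] :
  [/\ e c1 c0, e c2 c1, e c3 c2 & e c4 c3] /\ [/\ e c5 c4, e c0 c5, e z c0 & e z c1].
  by split; split; rewrite es.
have z2 : z != c2 by apply: contraNneq n02 => <-.
have z5 : z != c5 by apply: contraNneq n51 => <-; rewrite es.
have z0 := adj_neq ge ez0; have z1 := adj_neq ge ez1.
have n0 : nbs e c0 [:: c1; c5; z].
  by apply: nb_full; rewrite //= !inE negb_or d15 ![c1 == _]eq_sym z1 eq_sym z5.
have n1 : nbs e c1 [:: c0; c2; z].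
  by apply: nb_full; rewrite //= !inE negb_or d02 ![c0 == _]eq_sym z0 eq_sym z2.
have [r2 [a2 [b2 [n2 m2]]]] := third ge e21 e23 d13.
have [r3 [a3 [b3 [n3 m3]]]] := third ge e32 e34 d24.
have [r4 [a4 [b4 [n4 m4]]]] := third ge e43 e45 d35.
have d40 : c4 != c0 by rewrite eq_sym.
have [r5 [a5 [b5 [n5 m5]]]] := third ge e54 e50 d40.
have [rz [az [bz [nz mz]]]] := third ge ez0 ez1 d01.
pose S := [:: c0; c1; z; c2; c3; c4; c5].
have [] := @del_color S c0 c1 _ e01; first by rewrite inE eqxx.
  move=> m; rewrite !inE; do 6?[case/predU1P => [->|]]; last move=> /eqP->.
  - by exists c1, c5, z; split; rewrite // !inE eqxx ?orbT.
  - by exists c0, c2, z; split; rewrite // !inE eqxx ?orbT.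
  - by exists c0, c1, rz; split; rewrite // !inE eqxx ?orbT.
  - by exists c1, c3, r2; split; rewrite // !inE eqxx ?orbT.
  - by exists c2, c4, r3; split; rewrite // !inE eqxx ?orbT.
  - by exists c3, c5, r4; split; rewrite // !inE eqxx ?orbT.
  - by exists c4, c0, r5; split; rewrite // !inE eqxx ?orbT.
move=> g Lg pg.
(* The vertices that each list has to avoid, besides those of [S]. *)
have cov0 y : sq e c0 y -> y \in S ++ [:: r5; rz].
  move/(sq_cover n0 (fun=> n1) (fun=> n5) (fun=> nz)); move: y; sub_lists.
have cov1 y : sq e c1 y -> y \in S ++ [:: r2; rz].
  move/(sq_cover n1 (fun=> n0) (fun=> n2) (fun=> nz)); move: y; sub_lists.
have covz y : sq e z y -> y \in S ++ [:: rz; az; bz].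
  move/(sq_cover nz (fun=> n0) (fun=> n1) mz); move: y; sub_lists.
have cov2 y : sq e c2 y -> y \in S ++ [:: r2; a2; b2; r3].
  move/(sq_cover n2 (fun=> n1) (fun=> n3) m2); move: y; sub_lists.
have cov3 y : sq e c3 y -> y \in S ++ [:: r3; a3; b3; r2; r4].
  move/(sq_cover n3 (fun=> n2) (fun=> n4) m3); move: y; sub_lists.
have cov4 y : sq e c4 y -> y \in S ++ [:: r4; a4; b4; r3; r5].
  move/(sq_cover n4 (fun=> n3) (fun=> n5) m4); move: y; sub_lists.
have cov5 y : sq e c5 y -> y \in S ++ [:: r5; a5; b5; r4].
  move/(sq_cover n5 (fun=> n4) (fun=> n0) m5); move: y; sub_lists.
have av := avail_gt szL g.
have nz2 : ~~ e z c2.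
  by rewrite es; apply: (good_n4 ge z1 d02 ez0 e01 e12).
have nz5 : ~~ e z c5.
  by rewrite es; apply: (good_n4 ge z0 d15 ez1 e10 e05).
have z3 : z != c3 by apply: contraNneq nz2 => ->.
have z4 : z != c4 by apply: contraNneq nz5 => ->.
have nsz3 : ~~ sq e z c3 by apply: (path3_far ge z2 z3 d13 nz2 n13 ez1 e12 e23).
have nsz4 : ~~ sq e z c4.
  by apply: (path3_far ge z5 z4 d04 nz5 _ ez0 e05 e54); rewrite es.
have := @hexagon_triangle_color _ (avail L e g S c0) (avail L e g S c1) (avail L e g S z)
  (avail L e g S c2) (avail L e g S c3) (avail L e g S c4) (avail L e g S c5).
case; [exact: av cov0 _|exact: av cov1 _|exact: av covz _|exact: av cov2 _|
  exact: av cov3 _|exact: av cov4 _|exact: av cov5 _|].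
move=> k0 [k1 [kz [k2 [k3 [k4 [k5 [[[A0 A1 Az] [A2 A3 A4 A5]]]]]]]]].
rewrite /= !inE !negb_or !andbT => /andP[/andP[k01 k0z] k1z].
move=> /andP[/andP[k23 k24] k34] /andP[/andP[_ k35] k45].
case=> /and3P[k02 k04 k05] /and3P[k12 k13 k15] /andP[kz2 kz5].
apply: ncol; apply: (@extend_coloring _ _ _ _ g
  [:: (c0, k0); (c1, k1); (z, kz); (c2, k2); (c3, k3); (c4, k4); (c5, k5)]) => //=.
  apply/(@allP _ (fun p => p.2 \in avail L e g S p.1)) => /=.
  by rewrite A0 A1 Az A2 A3 A4 A5.
rewrite k01 k0z k02 k04 k05 k1z k12 k13 k15 kz2 kz5 k23 k24 k34 k35 k45.
by rewrite !implybT (negPf o03) (negPf o14) (negPf o25) (negPf nsz3) (negPf nsz4).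
Qed.

(** Otherwise there is a 4-cycle through the triangle. *)
Lemma triangle_pendant x y z m : e x y -> e x z -> e y z -> e x m ->
  m != z -> ~~ e y m.
Proof.
move=> xy xz yz xm mz; apply: (good_n4 ge mz (adj_neq ge xy)) => //; by rewrite es.
Qed.

(** The six vertices are deleted and coloured last.  A vertex of one triangle
    other than [x] and one of the other triangle other than [x'] are far apart,
    since anything closer would make a short cycle. *)
Lemma joined_triangles x y z x' u v :
  e x y -> e x z -> e y z -> e x x' -> x' != y -> x' != z ->
  e x' u -> e x' v -> e u v -> u != x -> v != x -> False.
Proof.
move=> xy xz yz xx' x'y x'z x'u x'v uv ux vx.
have [[yx zx zy] [x'x ux' vx' vu]] :
  [/\ e y x, e z x & e z y] /\ [/\ e x' x, e u x', e v x' & e v u].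
  by split; split; rewrite es.
have dxy := adj_neq ge xy; have dxz := adj_neq ge xz; have dyz := adj_neq ge yz.
have duv := adj_neq ge uv; have dx'u := adj_neq ge x'u; have dx'v := adj_neq ge x'v.
have nx : nbs e x [:: y; z; x'].
  by apply: nb_full; rewrite //= !inE negb_or dyz ![_ == x']eq_sym x'y x'z.
have nx' : nbs e x' [:: u; v; x] by apply: nb_full; rewrite //= !inE negb_or duv ux vx.
have pyx' : ~~ e y x' by apply: (triangle_pendant xy xz).
have pzx' : ~~ e z x' by apply: (triangle_pendant xz xy).
have pux : ~~ e u x by apply: (triangle_pendant x'u x'v) => //; rewrite eq_sym.
have pvx : ~~ e v x by apply: (triangle_pendant x'v x'u) => //; rewrite eq_sym.
have far a b : e a x -> a != x' -> ~~ e a x' -> e x' b -> b != x -> ~~ e b x -> ~~ sq e a b.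
  move=> ax ax' nax' x'b bx nbx.
  have ab : a != b by apply: contraNneq nax' => ->; rewrite es.
  by apply: (path3_far ge ax' ab _ nax' _ ax xx' x'b); rewrite 1?eq_sym // es.
have yx'N : y != x' by rewrite eq_sym.
have zx'N : z != x' by rewrite eq_sym.
have fyu := far y u yx yx'N pyx' x'u ux pux.
have fyv := far y v yx yx'N pyx' x'v vx pvx.
have fzu := far z u zx zx'N pzx' x'u ux pux.
have fzv := far z v zx zx'N pzx' x'v vx pvx.
have [ry [ay [by_ [ny my]]]] := third ge yx yz dxz.
have [rz [az [bz [nz mz]]]] := third ge zx zy dxy.
have [ru [au [bu [nu mu]]]] := third ge ux' uv dx'v.
have [rv [av [bv [nv mv]]]] := third ge vx' vu dx'u.
pose S := [:: x; y; z; x'; u; v].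
have [] := @del_color S x y _ xy; first by rewrite inE eqxx.
  move=> m; rewrite !inE; do 5?[case/predU1P => [->|]]; last move=> /eqP->.
  - by exists y, z, x'; split; rewrite // !inE eqxx ?orbT.
  - by exists x, z, ry; split; rewrite // !inE eqxx ?orbT.
  - by exists x, y, rz; split; rewrite // !inE eqxx ?orbT.
  - by exists u, v, x; split; rewrite // !inE eqxx ?orbT.
  - by exists x', v, ru; split; rewrite // !inE eqxx ?orbT.
  - by exists x', u, rv; split; rewrite // !inE eqxx ?orbT.
move=> g Lg pg.
(* The vertices that each list has to avoid, besides those of [S]. *)
have covx t : sq e x t -> t \in S ++ [:: ry; rz].
  move/(sq_cover nx (fun=> ny) (fun=> nz) (fun=> nx')); move: t; sub_lists.
have covy t : sq e y t -> t \in S ++ [:: ry; ay; by_; rz].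
  move/(sq_cover ny (fun=> nx) (fun=> nz) my); move: t; sub_lists.
have covz t : sq e z t -> t \in S ++ [:: rz; az; bz; ry].
  move/(sq_cover nz (fun=> nx) (fun=> ny) mz); move: t; sub_lists.
have covx' t : sq e x' t -> t \in S ++ [:: ru; rv].
  move/(sq_cover nx' (fun=> nu) (fun=> nv) (fun=> nx)); move: t; sub_lists.
have covu t : sq e u t -> t \in S ++ [:: ru; au; bu; rv].
  move/(sq_cover nu (fun=> nx') (fun=> nv) mu); move: t; sub_lists.
have covv t : sq e v t -> t \in S ++ [:: rv; av; bv; ru].
  move/(sq_cover nv (fun=> nx') (fun=> nu) mv); move: t; sub_lists.
have gt := avail_gt szL g.
have := @joined_triangles_color _ (avail L e g S x) (avail L e g S y) (avail L e g S z)
  (avail L e g S x') (avail L e g S u) (avail L e g S v).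
case; [exact: gt covx _|exact: gt covy _|exact: gt covz _|exact: gt covx' _|
  exact: gt covu _|exact: gt covv _|].
move=> kx [ky [kz [kx' [ku [kv [[Ax Ay Az] [Ax' Au Av]]]]]]].
rewrite /= !inE !negb_or !andbT => /and3P[/and3P[kxy kxz kxx'] /andP[kyz kyx'] kzx'].
move=> /and3P[/and3P[_ kxu kxv] /andP[kx'u kx'v] kuv].
apply: ncol; apply: (@extend_coloring _ _ _ _ g
  [:: (x, kx); (y, ky); (z, kz); (x', kx'); (u, ku); (v, kv)]) => //=.
  apply/(@allP _ (fun p => p.2 \in avail L e g S p.1)) => /=.
  by rewrite Ax Ay Az Ax' Au Av.
rewrite kxy kxz kxx' kyz kyx' kzx' kxu kxv kx'u kx'v kuv !implybT.
by rewrite (negPf fyu) (negPf fyv) (negPf fzu) (negPf fzv).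
Qed.

(** As in the previous lemma, except that one of [y], [z] and one of [u], [v]
    might have a common neighbour; but this would put an edge of the triangle on
    a hexagon. *)
Lemma linked_triangles x y z m x' u v :
  e x y -> e x z -> e y z -> e x m -> m != y -> m != z ->
  e m x' -> x' != x -> e x' u -> e x' v -> e u v -> u != m -> v != m -> False.
Proof.
move=> xy xz yz xm dmy dmz mx' x'x x'u x'v uv um vm.
have [[yx zx zy mx] [x'm ux' vx' vu]] :
  [/\ e y x, e z x, e z y & e m x] /\ [/\ e x' m, e u x', e v x' & e v u].
  by split; split; rewrite es.
have dxy := adj_neq ge xy; have dxz := adj_neq ge xz; have dyz := adj_neq ge yz.
have duv := adj_neq ge uv; have dx'u := adj_neq ge x'u; have dx'v := adj_neq ge x'v.
have dxm := adj_neq ge xm; have dmx' := adj_neq ge mx'.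
have xx' : x != x' by rewrite eq_sym.
have nx : nbs e x [:: y; z; m].
  by apply: nb_full; rewrite //= !inE negb_or dyz ![_ == m]eq_sym dmy dmz.
have nx' : nbs e x' [:: u; v; m] by apply: nb_full; rewrite //= !inE negb_or duv um vm.
have pym : ~~ e y m by apply: (triangle_pendant xy xz).
have pzm : ~~ e z m by apply: (triangle_pendant xz xy).
have pum : ~~ e u m by apply: (triangle_pendant x'u x'v) => //; rewrite eq_sym.
have pvm : ~~ e v m by apply: (triangle_pendant x'v x'u) => //; rewrite eq_sym.
have x'y : x' != y by apply: contraNneq pym => <-; rewrite es.
have x'z : x' != z by apply: contraNneq pzm => <-; rewrite es.
have ux : u != x by apply: contraNneq pum => ->.
have vx : v != x by apply: contraNneq pvm => ->.
have nxx' : ~~ e x x'.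
  by apply/negP => /nx; rewrite !inE (negPf x'y) (negPf x'z) eq_sym (negPf dmx').
have far1 a : e x a -> a != m -> a != x' -> ~~ e a m -> ~~ sq e a x'.
  move=> xa am ax' nam.
  by apply: (path3_far ge am ax' xx' nam nxx' _ xm mx'); rewrite es.
have far2 a : e x' a -> a != m -> a != x -> ~~ e a m -> ~~ sq e x a.
  move=> x'a am ax nam.
  by apply: (path3_far ge xx' _ _ nxx' _ xm mx' x'a); rewrite 1?eq_sym // es.
have fyx' : ~~ sq e y x' by apply: far1 => //; rewrite eq_sym.
have fzx' : ~~ sq e z x' by apply: far1 => //; rewrite eq_sym.
have fxu : ~~ sq e x u by apply: far2.
have fxv : ~~ sq e x v by apply: far2.
have sqP (a b : T) : a != b -> ~~ sq e a b -> ~~ e a b by move=> ab; rewrite /sq ab negb_or => /andP[].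
have far a c b : e x a -> e x c -> e a c -> a != m -> ~~ e a m -> ~~ sq e a x' ->
    a != x' -> e x' b -> b != m -> ~~ e b m -> b != x -> ~~ sq e x b -> ~~ sq e a b.
  move=> xa xc ac am nam nax' ax' x'b bm nbm bx nxb.
  have ax : e a x by rewrite es.
  have bx' : e b x' by rewrite es.
  have eax' := sqP _ _ ax' nax'; have exb : ~~ e x b by apply: sqP; rewrite 1?eq_sym.
  have dxa := adj_neq ge xa; have dx'b := adj_neq ge x'b.
  have ab : a != b by apply: contraNneq eax' => ->; rewrite es.
  rewrite /sq ab /= negb_or; apply/andP; split.
    by rewrite es; apply: (@good_n5 _ _ ge a x m x' b) => //; rewrite eq_sym.
  apply/existsPn => n; apply/negP => /andP[an nb].
  have nx_ : n != x by apply: contraNneq exb => <-.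
  have nm : n != m by apply: contraNneq nam => <-.
  have nx'_ : n != x' by apply: contraNneq eax' => <-.
  have dan := adj_neq ge an; have dnb := adj_neq ge nb.
  apply: (@hexagon_triangle a x c m x' b n) => //.
  rewrite /ucycle /= ax xm mx' x'b es nb es an /= !inE !negb_or.
  rewrite ![_ == n]eq_sym nx_ nm nx'_ am ax' ab dxm xx' dmx' dx'b ![n == _]eq_sym dan.
  by rewrite ![_ == b]eq_sym ?bx ?bm ?(eq_sym a) ?dxa ?[b == _]eq_sym ?dnb ?(eq_sym x) ?(eq_sym m) ?bx ?bm.
have dym : y != m by rewrite eq_sym.
have dzm : z != m by rewrite eq_sym.
have dyx' : y != x' by rewrite eq_sym.
have dzx' : z != x' by rewrite eq_sym.
have fyu : ~~ sq e y u by apply: (far y z u).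
have fyv : ~~ sq e y v by apply: (far y z v).
have fzu : ~~ sq e z u by apply: (far z y u).
have fzv : ~~ sq e z v by apply: (far z y v).
have [rm [am [bm [nm mm]]]] := third ge mx mx' xx'.
have [ry [ay [by_ [ny my]]]] := third ge yx yz dxz.
have [rz [az [bz [nz mz]]]] := third ge zx zy dxy.
have [ru [au [bu [nu mu]]]] := third ge ux' uv dx'v.
have [rv [av [bv [nv mv]]]] := third ge vx' vu dx'u.
pose S := [:: m; x; y; z; x'; u; v].
have [] := @del_color S m x _ mx; first by rewrite inE eqxx.
  move=> t; rewrite !inE; do 6?[case/predU1P => [->|]]; last move=> /eqP->.
  - by exists x, x', rm; split; rewrite // !inE eqxx ?orbT.
  - by exists y, z, m; split; rewrite // !inE eqxx ?orbT.
  - by exists x, z, ry; split; rewrite // !inE eqxx ?orbT.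
  - by exists x, y, rz; split; rewrite // !inE eqxx ?orbT.
  - by exists u, v, m; split; rewrite // !inE eqxx ?orbT.
  - by exists x', v, ru; split; rewrite // !inE eqxx ?orbT.
  - by exists x', u, rv; split; rewrite // !inE eqxx ?orbT.
move=> g Lg pg.
have covm t : sq e m t -> t \in S ++ [:: rm; am; bm].
  move/(sq_cover nm (fun=> nx) (fun=> nx') mm); move: t; sub_lists.
have covx t : sq e x t -> t \in S ++ [:: ry; rz; rm].
  move/(sq_cover nx (fun=> ny) (fun=> nz) (fun=> nm)); move: t; sub_lists.
have covy t : sq e y t -> t \in S ++ [:: ry; ay; by_; rz].
  move/(sq_cover ny (fun=> nx) (fun=> nz) my); move: t; sub_lists.
have covz t : sq e z t -> t \in S ++ [:: rz; az; bz; ry].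
  move/(sq_cover nz (fun=> nx) (fun=> ny) mz); move: t; sub_lists.
have covx' t : sq e x' t -> t \in S ++ [:: ru; rv; rm].
  move/(sq_cover nx' (fun=> nu) (fun=> nv) (fun=> nm)); move: t; sub_lists.
have covu t : sq e u t -> t \in S ++ [:: ru; au; bu; rv].
  move/(sq_cover nu (fun=> nx') (fun=> nv) mu); move: t; sub_lists.
have covv t : sq e v t -> t \in S ++ [:: rv; av; bv; ru].
  move/(sq_cover nv (fun=> nx') (fun=> nu) mv); move: t; sub_lists.
have gt := avail_gt szL g.
have := @linked_triangles_color _ (avail L e g S m) (avail L e g S x) (avail L e g S y)
  (avail L e g S z) (avail L e g S x') (avail L e g S u) (avail L e g S v).
case; [exact: gt covm _|exact: gt covx _|exact: gt covy _|exact: gt covz _|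
  exact: gt covx' _|exact: gt covu _|exact: gt covv _|].
move=> km [kx [ky [kz [kx' [ku [kv [[Am Ax Ay Az] [Ax' Au Av]]]]]]]].
rewrite /= !inE !negb_or !andbT => /and3P[/and3P[kmx kmy kmz] /andP[kxy kxz] kyz].
move=> /and3P[/and3P[kmx' kmu kmv] /andP[kx'u kx'v] kuv] kxx'.
apply: ncol; apply: (@extend_coloring _ _ _ _ g
  [:: (m, km); (x, kx); (y, ky); (z, kz); (x', kx'); (u, ku); (v, kv)]) => //=.
  apply/(@allP _ (fun p => p.2 \in avail L e g S p.1)) => /=.
  by rewrite Am Ax Ay Az Ax' Au Av.
rewrite kmx kmy kmz kxy kxz kyz kmx' kmu kmv kx'u kx'v kuv kxx' !implybT.
rewrite (negPf fyx') (negPf fzx') (negPf fxu) (negPf fxv).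
by rewrite (negPf fyu) (negPf fyv) (negPf fzu) (negPf fzv).
Qed.

End Triangles.

(** * Cutting the triangles open *)

Lemma heavy_budget b m : 0 < b -> b + (1 + (1 + 0) + (m + (1 + (1 + 0)))) <= 5 -> m = 0.
Proof. lia. Qed.

Lemma least_of_three a b d : a != b -> b != d -> d != a ->
  ~~ ((a < b) && (a < d)) -> ~~ ((b < d) && (b < a)) -> ~~ ((d < a) && (d < b)) -> False.
Proof. lia. Qed.

Lemma next_neq_prev (T : eqType) (c : seq T) x :
  uniq c -> 2 < size c -> x \in c -> next c x != prev c x.
Proof.
move=> uc sc xc; apply/eqP => np.
have : next c (next c x) = x by rewrite np next_prev.
have [i s rc] := rot_to xc; rewrite -!(next_rot i uc) rc.
have : uniq (x :: s) by rewrite -rc rot_uniq.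
have : 2 < size (x :: s) by rewrite -rc size_rot.
case: s {rc} => [|a [|b s]] //= _; rewrite eqxx !inE !negb_or.
move=> /and3P[/and3P[xa xb _] _ _]; rewrite ![a == _]eq_sym (negPf xa) eqxx => bx.
by rewrite bx eqxx in xb.
Qed.

Section Final.
Variables (T : finType) (C : choiceType) (L : T -> {fset C}).
Hypothesis szL : forall v, #|` L v| = 7.
Variable e : rel T.
Hypothesis ge : good e.
Hypothesis IH : forall e', good e' -> nedges e' < nedges e -> colorable L e'.
Hypothesis ncol : ~ colorable L e.
Let es := good_sym ge.
Let ei := good_irrefl ge.
Let ed := good_deg ge.
Let degE := degE szL ge IH ncol.

Definition in_triangle p := [exists a, exists b, [&& e p a, e p b & e a b]].

Lemma in_triangleP p a b : e p a -> e p b -> e a b -> in_triangle p.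
Proof. by move=> pa pb ab; apply/existsP; exists a; apply/existsP; exists b; rewrite pa pb. Qed.

Lemma triangle_third x y z p : e x y -> e x z -> e y z -> e x p -> p != y -> p != z ->
  ~~ e y p && ~~ e z p.
Proof.
move=> xy xz yz xp py pz; rewrite (triangle_pendant ge xy xz yz) //.
by rewrite (triangle_pendant ge xz xy) // es.
Qed.

(** A third neighbour of [x] is adjacent to neither [y] nor [z]. *)
Lemma triangle_uniq x y z a b : e x y -> e x z -> e y z -> e x a -> e x b -> e a b ->
  (a == y) && (b == z) || (a == z) && (b == y).
Proof.
move=> xy xz yz xa xb ab.
have oneP p q : e x p -> e x q -> e p q -> (p == y) || (p == z).
  move=> xp xq pq; apply/orP/orP/norP => -[py pz].
  have /andP[yp zp] := triangle_third xy xz yz xp py pz.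
  have nx : nbs e x [:: y; z; p].
    by apply: nb_full; rewrite //= !inE negb_or (adj_neq ge yz) ![_ == p]eq_sym py pz.
  have := nx _ xq; rewrite !inE => /or3P[]/eqP qE; move: pq; rewrite qE ?ei //.
    by rewrite es (negPf yp).
  by rewrite es (negPf zp).
have ba : e b a by rewrite es.
case/orP: (oneP a b xa xb ab) => /eqP aE; case/orP: (oneP b a xb xa ba) => /eqP bE;
  subst; rewrite ?eqxx ?orbT //; by rewrite ei in ab.
Qed.

Lemma pendant_not_in_triangle x y z p : e x y -> e x z -> e y z -> e x p ->
  p != y -> p != z -> ~~ in_triangle p.
Proof.
move=> xy xz yz xp py pz; apply/existsP => -[a /existsP[b /and3P[pa pb ab]]].
have px : e p x by rewrite es.
have no q r : e p q -> e p r -> e q r -> q != x.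
  move=> pq pr qr; apply/eqP => qx; subst q.
  by case/orP: (triangle_uniq xy xz yz xp qr pr) => /andP[/eqP pE _]; rewrite pE eqxx in py pz.
have ax := no a b pa pb ab; have bx : b != x by apply: (no b a); rewrite // es.
exact: (joined_triangles szL ge IH ncol xy xz yz xp py pz pa pb ab ax bx).
Qed.

Lemma pendant2_not_in_triangle x y z p r : e x y -> e x z -> e y z -> e x p ->
  p != y -> p != z -> e p r -> r != x -> ~~ in_triangle r.
Proof.
move=> xy xz yz xp py pz pr rx; apply/existsP => -[u /existsP[v /and3P[ru rv uv]]].
have npt := pendant_not_in_triangle xy xz yz xp py pz.
have rp : e r p by rewrite es.
have no a b : e r a -> e r b -> e a b -> a != p.
  move=> ra rb ab; apply: contraNneq npt => aE; subst a.
  exact: in_triangleP pr ab rb.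
have up := no u v ru rv uv; have vp : v != p by apply: (no v u); rewrite // es.
exact: (linked_triangles szL ge IH ncol xy xz yz xp py pz pr rx ru rv uv up vp).
Qed.

Local Notation rk := enum_rank.

Definition apex t x y := [&& e t x, e t y, (rk t < rk x)%N & (rk t < rk y)%N].
(** Every triangle loses the edge opposite to its vertex of least rank.  For
    counting vertices of degree three along cycles this has the effect of
    contracting the triangle to that vertex, but it stays within subgraphs. *)
Definition cut : rel T := fun x y => e x y && ~~ [exists t, apex t x y].

Lemma cut_sub : subrel cut e. Proof. by move=> x y /andP[]. Qed.

Lemma apex_sym t x y : apex t x y = apex t y x.
Proof. by rewrite /apex andbCA; do 2!congr andb; exact: andbC. Qed.

Lemma cut_sym : symmetric cut.
Proof.
by move=> x y; rewrite /cut es; congr (_ && ~~ _); apply: eq_existsb => t; apply: apex_sym.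
Qed.

Definition heavy x := deg cut x == 3.

Lemma not_in_triangle_heavy p q : e p q -> ~~ in_triangle p -> heavy p.
Proof.
move=> pq npt; rewrite /heavy -(degE pq); apply/eqP/eq_deg => y.
rewrite /cut; case epy: (e p y) => //=; apply/negP => /existsP[t /and4P[tp ty _ _]].
by case/negP: npt; apply: (@in_triangleP p t y) => //; rewrite es.
Qed.

Lemma light_apex p q : e p q -> ~~ heavy p -> exists t z, [/\ apex t p z, e p z & ~~ cut p z].
Proof.
move=> pq /eqP np; suff [z pz npz] : exists2 z, e p z & ~~ cut p z.
  by move: (npz); rewrite /cut pz negbK /= => /existsP[t tpz]; exists t, z.
apply/exists_inP; apply: contraPT np; rewrite negb_exists_in => /forall_inP H.
apply; rewrite -(degE pq); apply: eq_deg => y; apply/idP/idP => [/cut_sub//|].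
by move=> /H; rewrite negbK.
Qed.

Lemma apex_heavy t x y : apex t x y -> e x y -> heavy t.
Proof.
case/and4P=> tx ty rtx rty xy; apply/negPn/negP => nt.
have [s [z [/and4P[st sz rst rsz] tz _]]] := light_apex tx nt.
have ts : e t s by rewrite es.
by case/orP: (triangle_uniq tx ty xy ts tz sz) => /andP[/eqP sE _]; subst s;
  rewrite ltnNge ltnW in rst.
Qed.

Lemma cut_deg x : deg cut x != 1.
Proof.
apply/negP => /cards1P[y /setP xE].
have xy : cut x y by have := xE y; rewrite !inE eqxx.
have exy := cut_sub xy.
have [p [q [upq xp xq _]]] := nbsE szL ge IH ncol exy.
move: upq; rewrite /= !inE negb_or andbT => /andP[/andP[yp yq] pq].
have no r : r != y -> e x r -> exists t, apex t x r.
  move=> ry xr; have : ~~ cut x r by have := xE r; rewrite !inE (negPf ry) => ->.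
  by rewrite /cut xr negbK => /existsP.
have [|t tp] := no p _ xp; first by rewrite eq_sym.
have [|s sq] := no q _ xq; first by rewrite eq_sym.
case/and4P: tp => tx tp rtx rtp; case/and4P: sq => sx sq_ rsx rsq.
have xt : e x t by rewrite es.
have xs : e x s by rewrite es.
case/orP: (triangle_uniq xt xp tp xs xq sq_) => /andP[/eqP sE /eqP qE].
  by rewrite qE eqxx in pq.
by rewrite sE qE ltnNge ltnW in rsq.
Qed.

(** A vertex on a cycle that is not heavy has lost an edge.  Two are left, one of
    them to the apex of its triangle, and the cycle uses both. *)
Lemma light_neighbour c m : ucycle cut c -> 2 < size c -> m \in c -> ~~ heavy m ->
  exists t z, [/\ apex t m z, e m z, ~~ cut m z & (next c m == t) || (prev c m == t)].
Proof.
case/andP=> cc uc sc mc hm.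
have mn := next_cycle cc mc; have := prev_cycle cc mc; rewrite cut_sym => mp.
have [t [z [tm mz nmz]]] := light_apex (cut_sub mn) hm; exists t, z; split=> //.
apply/negPn/negP; rewrite negb_or => /andP[nt pt].
have np := next_neq_prev uc sc mc.
have mt : e m t by rewrite es; case/and4P: tm.
have tz : e t z by case/and4P: tm.
have nz : next c m != z by apply: contraNneq nmz => <-.
have pz : prev c m != z by apply: contraNneq nmz => <-.
have : nbs e m [:: next c m; t; z].
  apply: nb_full; rewrite //= ?(cut_sub mn) // !inE negb_or nt nz.
  by rewrite (adj_neq ge tz).
move/(_ _ (cut_sub mp)); rewrite !inE (negPf pt) (negPf pz) !orbF eq_sym.
by rewrite (negPf np).
Qed.

(** The block [b] is the part of the cycle in one triangle, with its only heavy
    vertex [x].  This vertex and the two on either side of the block exhaust the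
    five heavy vertices.  A vertex of [mid] would not be heavy; its apex is heavy,
    lies in a triangle and on the cycle, so it would be [x], whose neighbours on
    the cycle are not in [mid]. *)
Lemma middle_nil c b p p2 q2 q mid x : ucycle cut c -> count heavy c <= 5 ->
  c = b ++ [:: p; p2] ++ mid ++ [:: q2; q] ->
  x \in b -> heavy x -> (forall t, t \in b -> heavy t -> t = x) ->
  next c x \notin mid -> prev c x \notin mid ->
  ~~ in_triangle p -> ~~ in_triangle p2 -> ~~ in_triangle q2 -> ~~ in_triangle q ->
  mid = [::].
Proof.
move=> cc; have /andP[cc' uc] := cc.
move=> hc cE xb hx bx nx px np np2 nq2 nq.
have hv r : r \in c -> ~~ in_triangle r -> heavy r.
  by move=> rc; apply: not_in_triangle_heavy (cut_sub (next_cycle cc' rc)).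
have [hp hp2 hq2 hq] : [/\ heavy p, heavy p2, heavy q2 & heavy q].
  by split; apply: hv; rewrite // cE !mem_cat !inE eqxx ?orbT.
have hmid : count heavy mid = 0.
  move: hc; rewrite cE !count_cat /= hp hp2 hq2 hq.
  have : 0 < count heavy b by rewrite -has_count; apply/hasP; exists x.
  by move=> b0 le5; apply: heavy_budget b0 le5.
case: mid cE nx px hmid => // m mid cE nx px hmid.
have mm : m \in m :: mid by rewrite inE eqxx.
have lightmid r : r \in m :: mid -> ~~ heavy r.
  move=> rm; apply/negP => hr; have : has heavy (m :: mid) by apply/hasP; exists r.
  by rewrite has_count hmid.
have mc : m \in c by rewrite cE !mem_cat mm !orbT.
have sc : 2 < size c by rewrite cE size_cat; apply: leq_trans (leq_addl _ _).
have [t [z [tm mz _ tE]]] := light_neighbour cc sc mc (lightmid m mm).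
have tc : t \in c by case/orP: tE => /eqP <-; rewrite ?mem_next ?mem_prev.
have ht := apex_heavy tm mz.
have it : in_triangle t by case/and4P: tm => t1 t2 _ _; apply: in_triangleP t1 t2 mz.
(* The apex cannot be one of the four outer vertices, which are in no triangle. *)
have {}tb : t = x.
  apply: bx => //; move: tc; rewrite cE !mem_cat => /or4P[//| | |].
  - by rewrite !inE => /orP[]/eqP tE'; subst t; rewrite it in np np2.
  - by move/lightmid; rewrite ht.
  - by rewrite !inE => /orP[]/eqP tE'; subst t; rewrite it in nq nq2.
subst t; case/orP: tE => /eqP tE.
  by case/negP: px; rewrite -tE prev_next.
by case/negP: nx; rewrite -tE next_prev.
Qed.

Lemma apex_cut t x y : apex t x y -> ~~ cut x y.
Proof. by move=> txy; rewrite /cut negb_and negbK; apply/orP; right; apply/existsP; exists t. Qed.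

(** Next to the part of the cycle inside the triangle [x y z] there are two
    vertices on either side that lie in no triangle, and nothing else by
    [middle_nil].  Thus the cycle is a hexagon through the edge [y x], or becomes
    one through the edge [y z] when the vertex [x] is bypassed. *)
Lemma light_start s y x z : ucycle cut (y :: x :: s) -> 0 < size s ->
  count heavy (y :: x :: s) <= 5 -> apex x y z -> e y z -> ~~ heavy y -> ~~ heavy z -> False.
Proof.
move=> cc s0 hc xyz yz ly lz; have /and4P[xy xz _ _] := xyz.
have hx := apex_heavy xyz yz.
have nyz := apex_cut xyz.
have yx : e y x by rewrite es.
have zx : e z x by rewrite es.
have zy : e z y by rewrite es.
have ce := sub_ucycle cut_sub cc.
case: s s0 cc hc ce => // p s _ cc hc ce.
have [pz|pz] := eqVneq p z.
  subst p; case: s cc hc ce => [|p1 s] cc hc ce.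
    by move: cc nyz; rewrite /ucycle /= => /andP[/and4P[_ _ czy _] _]; rewrite cut_sym czy.
  case/lastP: s cc hc ce => [|s q] cc hc ce; first by have := good_no4 ge ce.
  case: s cc hc ce => [|p2 s] cc hc ce; first by have := good_no5 ge ce.
  (* Bypassing [x] shortens the cycle by one. *)
  have {ce} c5 : ucycle e (y :: z :: p1 :: rcons (p2 :: s) q).
    move: ce; rewrite /ucycle /= yz !inE => /and3P[/and4P[_ _ -> ->]].
    by rewrite !negb_or => /and4P[_ -> -> ->] /and3P[_ -> ->].
  case/lastP: s cc hc c5 => [|mid q2] cc hc c5; first by have := good_no5 ge c5.
  have cE : [:: y, x, z, p1 & rcons (p2 :: rcons mid q2) q] = [:: y; x; z] ++ [:: p1; p2] ++ mid ++ [:: q2; q].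
    by rewrite /= -!cats1 -catA.
  have := c5; rewrite /ucycle /= !rcons_path !last_rcons => /andP[+ _].
  case/and3P=> _ zp1 /andP[p12 /andP[/andP[_ q2q] qy]].
  have uc : uniq [:: y, x, z, p1, p2 & rcons (rcons mid q2) q] by case/andP: cc.
  have := uc; rewrite /= !(inE, mem_rcons, rcons_uniq) !negb_or -!andbA.
  case/and5P=> dyx dyz dyp1 dyp2 /and5P[dyq dyq2 ymid dxz].
  case/and5P=> dxp1 dxp2 dxq dxq2 /and5P[xmid dzp1 dzp2 dzq /and3P[dzq2 zmid _]].
  have yq : e y q by rewrite es.
  have qq2 : e q q2 by rewrite es.
  have h1 : ~~ in_triangle p1.
    by apply: (pendant_not_in_triangle zx zy xy zp1); rewrite eq_sym.
  have h2 : ~~ in_triangle p2.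
    by apply: (pendant2_not_in_triangle zx zy xy zp1 _ _ p12); rewrite eq_sym.
  have h3 : ~~ in_triangle q.
    by apply: (pendant_not_in_triangle yx yz xz yq); rewrite eq_sym.
  have h4 : ~~ in_triangle q2.
    by apply: (pendant2_not_in_triangle yx yz xz yq _ _ qq2); rewrite eq_sym.
  have nc : next [:: y, x, z, p1, p2 & rcons (rcons mid q2) q] x = z.
    by rewrite /= (eq_sym x y) (negPf dyx) eqxx.
  have pc : prev [:: y, x, z, p1, p2 & rcons (rcons mid q2) q] x = y.
    by have := prev_next uc y; rewrite [next _ y]/= eqxx.
  have := middle_nil cc hc cE (x := x); rewrite nc pc.
  rewrite !inE eqxx orbT => /(_ isT hx _ zmid ymid h1 h2 h4 h3) mid0.
  rewrite {}mid0 in c5; last first.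
    by move=> t; rewrite !inE => /or3P[]/eqP-> //; [rewrite (negPf ly)|rewrite (negPf lz)].
  exact: (hexagon_triangle szL ge IH ncol yx zx c5).
case: s cc hc ce => [|p2 s] cc hc ce.
  move: ce; rewrite /ucycle /= !inE negb_or => /andP[/and4P[_ xp py _] /and3P[/andP[dyx dyp] _ _]].
  have : p != y by rewrite eq_sym.
  by move=> /(triangle_third xy xz yz xp)/(_ pz)/andP[]; rewrite es py.
case/lastP: s cc hc ce => [|s q] cc hc ce; first by have := good_no4 ge ce.
case/lastP: s cc hc ce => [|mid q2] cc hc ce; first by have := good_no5 ge ce.
have cE : [:: y, x, p, p2 & rcons (rcons mid q2) q] = [:: y; x] ++ [:: p; p2] ++ mid ++ [:: q2; q].
  by rewrite /= -!cats1 -catA.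
have qz : q != z.
  have := cc; rewrite /ucycle /= !rcons_path !last_rcons => /andP[+ _].
  case/and4P=> _ _ _ /andP[_ qy].
  by apply: contraNneq nyz => <-; rewrite cut_sym.
have := ce; rewrite /ucycle /= !rcons_path !last_rcons => /andP[+ _].
case/and4P=> _ xp pp2 /andP[/andP[_ q2q] qy].
have uc : uniq [:: y, x, p, p2 & rcons (rcons mid q2) q] by case/andP: cc.
have := uc; rewrite /= !(inE, mem_rcons, rcons_uniq) !negb_or -!andbA.
case/and5P=> dyx dyp dyp2 dyq /and5P[dyq2 ymid dxp dxp2].
case/and5P=> dxq dxq2 xmid dpp2 /and4P[dpq dpq2 pmid _].
have yq : e y q by rewrite es.
have qq2 : e q q2 by rewrite es.
have py : p != y by rewrite eq_sym.
have h1 : ~~ in_triangle p by apply: (pendant_not_in_triangle xy xz yz xp).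
have h2 : ~~ in_triangle p2.
  by apply: (pendant2_not_in_triangle xy xz yz xp _ _ pp2); rewrite // eq_sym.
have h3 : ~~ in_triangle q.
  by apply: (pendant_not_in_triangle yx yz xz yq); rewrite // eq_sym.
have h4 : ~~ in_triangle q2.
  by apply: (pendant2_not_in_triangle yx yz xz yq _ _ qq2); rewrite // eq_sym.
have nc : next [:: y, x, p, p2 & rcons (rcons mid q2) q] x = p.
  by rewrite /= (eq_sym x y) (negPf dyx) eqxx.
have pc : prev [:: y, x, p, p2 & rcons (rcons mid q2) q] x = y.
  by have := prev_next uc y; rewrite [next _ y]/= eqxx.
have := middle_nil cc hc cE (x := x); rewrite nc pc.
rewrite !inE eqxx orbT => /(_ isT hx _ pmid ymid h1 h2 h4 h3) mid0.
rewrite {}mid0 in ce; last first.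
  by move=> t; rewrite !inE => /orP[]/eqP-> //; rewrite (negPf ly).
exact: (hexagon_triangle szL ge IH ncol yz xz ce).
Qed.

Lemma no_cut_triangle a b d : cut a b -> cut b d -> cut d a -> False.
Proof.
move=> ab bd da; have [eab ebd eda] := And3 (cut_sub ab) (cut_sub bd) (cut_sub da).
have sm x y z : e x y -> e x z -> cut y z -> ~~ ((rk x < rk y)%N && (rk x < rk z)%N).
  by move=> xy xz; apply: contraL => /andP[r1 r2]; apply: (@apex_cut x); rewrite /apex xy xz r1.
have [eba edb ead] : [/\ e b a, e d b & e a d] by split; rewrite es.
have H1 := sm a b d eab ead bd; have H2 := sm b d a ebd eba da.
have H3 := sm d a b eda edb ab.
have neq x y : e x y -> rk x != rk y :> nat.
  by move/(adj_neq ge); apply: contra => /eqP/val_inj/enum_rank_inj->.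
exact: least_of_three (neq a b eab) (neq b d ebd) (neq d a eda) H1 H2 H3.
Qed.

Lemma heavy_in_cut_cycle c : ucycle cut c -> 2 < size c -> 5 < count heavy c.
Proof.
move=> cc sc; rewrite ltnNge; apply/negP => hc.
have /andP[cc' uc] := cc.
have [ah|/allPn[y yc ly]] := boolP (all heavy c).
  move: hc; rewrite (_ : count heavy c = size c); last by apply/eqP; rewrite -all_count.
  have ce := sub_ucycle cut_sub cc; move: (good_no4 ge ce) (good_no5 ge ce).
  case: c cc {cc' uc ah ce} sc => [|a [|b [|d [|a' [|b' [|]]]]]] //= cc _ _ _ _.
  by move: cc => /andP[/and4P[ab bd da _] _]; apply: (no_cut_triangle ab bd da).
have [x [z [xyz yz nyz xE]]] := light_neighbour cc sc yc ly.
have lz : ~~ heavy z.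
  apply/negP => /eqP dz; have := degE (_ : e z y); rewrite es yz => /(_ isT).
  rewrite -dz => /eqP; rewrite eq_sym; apply/negP; rewrite neq_ltn; apply/orP; left.
  apply: proper_card; apply/properP; split.
    by apply/subsetP => t; rewrite !inE => /cut_sub.
  by exists y; rewrite !inE ?[e z y]es // cut_sym.
have main c' : ucycle cut c' -> 2 < size c' -> count heavy c' <= 5 -> y \in c' -> next c' y = x -> False.
  move=> cc2 sc2 hc2 yc2 nx; have [i s rc] := rot_to yc2.
  have : next (y :: s) y = x by rewrite -rc next_rot //; case/andP: cc2.
  have : ucycle cut (y :: s) by rewrite -rc rot_ucycle.
  have : count heavy (y :: s) <= 5.
    by have /permP -> : perm_eq (y :: s) c' by rewrite -rc perm_rot.
  have : 2 < size (y :: s) by rewrite -rc size_rot.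
  case: s {rc} => [|a s] //= ss hs cs; rewrite eqxx => aE; subst a.
  by apply: (light_start cs _ hs xyz yz ly lz).
case/orP: xE => /eqP xE; first exact: main cc sc hc yc xE.
apply: (main (rev c)); rewrite ?size_rev ?mem_rev ?count_rev ?next_rev //.
rewrite /ucycle rev_uniq uc andbT rev_cycle; apply: sub_cycle cc' => u v.
by rewrite /= cut_sym.
Qed.

Lemma no_edges x y : ~~ e x y.
Proof.
apply/negP => xy; have [||c [cc sc]] := good_sparse ge cut_sym cut_sub.
- have [cxy|] := boolP (cut x y); first by exists x, y.
  rewrite /cut xy negbK /= => /existsP[t txy].
  have /card_gt0P[z] : 0 < #|[set z | cut t z]|.
    by rewrite -/(deg cut t) (eqP (apex_heavy txy xy)).
  by rewrite inE => tz; exists t, z.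
- exact: cut_deg.
by rewrite leqNgt heavy_in_cut_cycle.
Qed.
End Final.

Theorem good_colorable (T : finType) (C : choiceType) (L : T -> {fset C}) (e : rel T) :
  (forall v, #|` L v| = 7) -> good e -> colorable L e.
Proof.
move=> szL; have [n] := ubnP (nedges e); elim: n e => // n IHn e ltn ge.
apply: contrapT => ncol.
have IH e' : good e' -> nedges e' < nedges e -> colorable L e'.
  by move=> ge' lt; apply: IHn => //; apply: leq_trans lt _.
have ne := no_edges szL ge IH ncol; apply: ncol.
have L0 v : exists c, c \in L v by apply/fset0Pn; rewrite -cardfs_gt0 szL.
exists (fun v => xchoose (L0 v)) => [v|u v _ _ /andP[_]]; first exact: xchooseP.
by rewrite (negPf (ne _ _)) => /existsP[m]; rewrite (negPf (ne _ _)).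
Qed.

(** * Counting faces modulo two *)

Lemma iota_rcons i n : iota i n.+1 = rcons (iota i n) (i + n).
Proof. by rewrite -[n.+1]addn1 iotaD cats1. Qed.

Section Walk.
Variables (T : finType) (e : rel T) (t : nat -> T).
Hypotheses (ei : irreflexive e) (et : forall i, e (t i) (t i.+1)).
Hypothesis nbt : forall i, t i.+2 != t i.

Lemma walk_path i n : path e (t i) [seq t k | k <- iota i.+1 n].
Proof. by elim: n i => //= n IHn i; rewrite et IHn. Qed.

(** Stop at the first repeated vertex.  The stretch between its two visits is
    longer than two because the walk does not turn back. *)
Lemma walk_cycle : exists i n, ucycle e [seq t k | k <- iota i n] /\ 2 < n.
Proof.
have ex : exists n, ~~ uniq [seq t k | k <- iota 0 n].
  exists #|T|.+1; apply/negP => /card_uniqP; rewrite size_map size_iota => cT.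
  by have := max_card (mem [seq t k | k <- iota 0 #|T|.+1]); rewrite cT ltnn.
case: (ex_minnP ex) => -[//|m]; rewrite iota_rcons map_rcons rcons_uniq add0n.
rewrite negb_and negbK => tm minm.
have um : uniq [seq t k | k <- iota 0 m].
  by apply/negPn/negP => /minm; rewrite ltnn.
rewrite um orbF in tm; case/mapP: tm => i; rewrite mem_iota /= add0n => im tE.
exists i, (m - i); have [n nE] : exists n, m - i = n.+1 by exists (m - i).-1; lia.
have mE : m = i + n.+1 by lia.
split.
  rewrite nE /ucycle /=; apply/andP; split.
    rewrite -[X in rcons _ X]tE mE addnS -addSn -map_rcons -iota_rcons.
    exact: walk_path.
  have := um; rewrite mE iotaD map_cat cat_uniq add0n => /and3P[_ _].
  by [].
rewrite nE ltnS; case: n {nE} mE => [|[|n]] mE //.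
  by have := et i; rewrite -[X in e X _]tE mE addn1 ei.
by have := nbt i; rewrite -tE mE addn2 eqxx.
Qed.
End Walk.

Section Euler.
Variables (T : finType) (e : rel T) (nx : T -> T -> T).
Hypotheses (es : symmetric e) (ei : irreflexive e).
Hypothesis nxP : forall x y, e x y -> e y (nx x y) && (nx x y != x).

Definition even_rel (z : rel T) := forall x, \big[addb/false]_y z x y = false.

(** Think of [nx x y] as the vertex after [y] on the facial walk that arrives
    from [x], and of [w x y] as the parity with which [z] winds around the face
    to the left of the dart [x y]. *)
Hypothesis sides : forall z : rel T, symmetric z -> subrel z e -> even_rel z ->
  exists w : T -> T -> bool, forall x y, e x y ->
    w y (nx x y) = w x y /\ w x y (+) w y x = z x y.

Local Notation dart := (T * T)%type.
Definition darts : {set dart} := [set p | e p.1 p.2].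
Definition step (p : dart) : dart := (p.2, nx p.1 p.2).
Definition flip (p : dart) : dart := (p.2, p.1).
Definition step_rel : rel dart := fun p q =>
  [&& p \in darts, q \in darts & (step p == q) || (step q == p)].

Local Notation face := (fingraph.root step_rel).

Lemma flipK : involutive flip. Proof. by case. Qed.

Lemma step_dart p : p \in darts -> step p \in darts.
Proof. by rewrite !inE => /nxP/andP[]. Qed.

Lemma flip_dart p : (flip p \in darts) = (p \in darts).
Proof. by rewrite !inE es. Qed.

Lemma step_rel_sym : connect_sym step_rel.
Proof.
by apply: sym_connect_sym => p q; rewrite /step_rel andbCA orbC.
Qed.

Lemma step_connect p : p \in darts -> connect step_rel p (step p).
Proof. by move=> pD; apply: connect1; rewrite /step_rel pD step_dart // eqxx. Qed.

Definition faces := [set face p | p in darts].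

Section FaceCount.
Variable k : nat.
Variable heavy : pred T.
Hypothesis hc : forall c, ucycle e c -> 2 < size c -> k <= count heavy c.

(** The facial walk from a dart never turns back, so it runs around a cycle,
    whose heavy vertices are tails of darts of the same face. *)
Lemma face_heavy f : f \in faces ->
  k <= #|[set q in darts | heavy q.1 & face q == f]|.
Proof.
case/imsetP=> p pD ->; pose d i := iter i step p.
have dD i : d i \in darts by elim: i => //= i; apply: step_dart.
have dr i : face (d i) = face p.
  elim: i => //= i <-; apply/eqP; rewrite (root_connect step_rel_sym) step_rel_sym.
  exact: step_connect.
have [i [n [cc n2]]] : exists i n, ucycle e [seq (d k).1 | k <- iota i n] /\ 2 < n.
  apply: (walk_cycle ei) => i; first by have := dD i; rewrite inE.
  by have := dD i; rewrite inE => /nxP/andP[].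
set c := [seq _ | _ <- _] in cc; have /andP[_ uc] := cc.
apply: leq_trans (hc cc _) _; first by rewrite size_map size_iota.
rewrite -size_filter -(card_uniqP _); last exact: filter_uniq.
set S := [set q in darts | _]; apply: leq_trans (leq_imset_card fst S).
apply/subset_leq_card/subsetP => x; rewrite mem_filter => /andP[hx /mapP[j _ xE]].
by apply/imsetP; exists (d j) => //; rewrite inE dD -xE hx dr eqxx.
Qed.

Lemma card_darts (P : pred T) : #|[set q in darts | P q.1]| = \sum_(x | P x) deg e x.
Proof.
rewrite -sum1_card; transitivity (\sum_(x | P x) \sum_(y | e x y) 1); last first.
  by apply: eq_bigr => x _; rewrite sum1_card /deg; apply: eq_card => y; rewrite inE.
by rewrite pair_big_dep; apply: eq_bigl => -[x y]; rewrite !inE andbC.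
Qed.

Lemma faces_heavy : k * #|faces| <= #|[set q in darts | heavy q.1]|.
Proof.
rewrite -[X in _ <= X]sum1_card (partition_big face (mem faces)) /=; last first.
  by move=> p; rewrite inE => /andP[pD _]; apply: imset_f.
rewrite mulnC -sum_nat_const; apply: leq_sum => f fF.
apply: leq_trans (face_heavy fF) _; rewrite sum1_card; apply/subset_leq_card/subsetP => p.
by rewrite !inE unfold_in /= !inE => /and3P[-> -> ->].
Qed.
End FaceCount.

Definition circulations : {set {set dart}} := [set A : {set dart} | [&& A \subset darts,
  [forall p, (flip p \in A) == (p \in A)] &
  [forall x, \big[addb/false]_y ((x, y) \in A) == false]]].

Section Potentials.
Variable p0 : dart.
Hypothesis p0D : p0 \in darts.

(** Unions of faces.  A set and its complement have the same differential; the
    condition at [p0] keeps one of the two and so gains a factor of two in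
    [card_potentials]. *)
Definition potentials : {set {set dart}} := [set w : {set dart} | [&& w \subset darts,
  [forall p in darts, (step p \in w) == (p \in w)] & p0 \notin w]].

Definition differential (w : {set dart}) :=
  [set p in darts | (p \in w) (+) (flip p \in w)].

Lemma circulation_potential : circulations \subset differential @: potentials.
Proof.
apply/subsetP => A; rewrite inE => /and3P[/subsetP AD /forallP As /forallP Aeven].
have [x y|x y /AD|x|w wP] := sides (z := fun x y => (x, y) \in A).
- by rewrite -(eqP (As (x, y))).
- by rewrite inE.
- exact/eqP/Aeven.
apply/imsetP; exists [set p in darts | w p.1 p.2 (+) w p0.1 p0.2].
  rewrite inE; apply/and3P; split.
  - by apply/subsetP => p; rewrite inE => /andP[].
  - apply/forall_inP => p pD; move: (step_dart pD); rewrite !inE in pD *.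
    by rewrite /= pD (wP _ _ pD).1 => ->.
  - by rewrite inE addbb andbF.
apply/setP => -[x y]; rewrite !in_set.
rewrite /= (es y x); case exy: (e x y) => /=; last first.
  by apply/negP => /AD; rewrite inE /= exy.
rewrite -(wP _ _ exy).2.
by case: (w x y); case: (w y x); case: (w _ _).
Qed.

Lemma potential_face w p : w \in potentials -> p \in darts -> (p \in w) = (face p \in w).
Proof.
rewrite inE => /and3P[_ /forall_inP ws _] pD.
have cw : closed step_rel (mem w).
  move=> a b /and3P[aD bD /orP[]/eqP <-]; rewrite /= ?(eqP (ws _ aD)) //.
  by rewrite (eqP (ws _ bD)).
exact: (closed_connect cw (connect_root step_rel p)).
Qed.

Lemma card_potentials : #|potentials| <= 2 ^ #|faces|.-1.
Proof.
have f0 : face p0 \in faces by apply: imset_f.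
have -> : #|faces|.-1 = #|faces :\ face p0| by rewrite (cardsD1 (face p0) faces) f0.
rewrite -card_powerset.
rewrite -(@card_in_imset _ _ (fun w : {set dart} => w :&: faces)) => [|w w' wP wP' ww'].
  apply/subset_leq_card/subsetP => _ /imsetP[w wP ->]; rewrite powersetE.
  apply/subsetP => p; rewrite !inE => /andP[pw ->]; rewrite andbT.
  apply: contraTneq pw => ->; rewrite -potential_face //.
  by move: wP; rewrite inE => /and3P[].
have sub (v : {set dart}) p : v \in potentials -> p \in v -> p \in darts.
  by rewrite inE => /and3P[/subsetP vD _ _] /vD.
apply/setP => p; have [pD|pD] := boolP (p \in darts); last first.
  by apply/idP/idP => [/(sub _ _ wP)|/(sub _ _ wP')]; rewrite (negPf pD).
rewrite (potential_face wP pD) (potential_face wP' pD).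
have := congr1 (fun v : {set dart} => face p \in v) ww'.
by rewrite !(in_setI (face p)) imset_f // !andbT.
Qed.

Lemma card_circulations : #|circulations| <= 2 ^ #|faces|.-1.
Proof.
apply: leq_trans card_potentials; apply: leq_trans (leq_imset_card differential _).
exact: subset_leq_card circulation_potential.
Qed.
End Potentials.

Local Notation rk := enum_rank.
Definition edges : {set dart} := [set p in darts | (rk p.1 < rk p.2)%N].
Definition verts : {set T} := [set x | 0 < deg e x].

Lemma card_edges : #|darts| = 2 * #|edges|.
Proof.
have -> : darts = edges :|: flip @: edges.
  apply/setP => p; rewrite -[in RHS](flipK p) in_setU (mem_imset _ _ (inv_inj flipK)) !flipK.
  rewrite !inE /=; case: p => x y /=; rewrite (es y x).
  case exy: (e x y) => //=; case: ltngtP => // /val_inj/enum_rank_inj xy.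
  by rewrite xy ei in exy.
rewrite cardsU card_imset; last exact: inv_inj flipK.
rewrite (_ : _ :&: _ = set0) ?cards0 ?subn0 ?mul2n ?addnn //.
apply/setP => p; rewrite -[p]flipK in_setI (mem_imset _ _ (inv_inj flipK)) !inE /=.
by case: ltngtP; rewrite ?andbF.
Qed.

Definition symc (A : {set dart}) := [set p | (p \in A) || (flip p \in A)].
Definition bdry (A : {set dart}) := [set x | \big[addb/false]_y ((x, y) \in symc A)].
(** A base point of the fibre of the boundary map over [B], if the fibre is not
    empty. *)
Definition rep (B : {set T}) := odflt set0 [pick A : {set dart} | (A \subset edges) && (bdry A == B)].

Lemma rep_sub B : rep B \subset edges.
Proof. by rewrite /rep; case: pickP => [A /andP[]|_] //=; rewrite sub0set. Qed.

Lemma rep_bdry (A : {set dart}) : A \subset edges -> bdry (rep (bdry A)) = bdry A.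
Proof.
by move=> AE; rewrite /rep; case: pickP => [B /andP[_ /eqP->]|/(_ A)] //; rewrite AE eqxx.
Qed.

Lemma symc_darts (A : {set dart}) p : A \subset edges -> p \in symc A -> p \in darts.
Proof.
move=> /subsetP AE; rewrite inE -[p \in darts]orbb -{2}flip_dart.
have ED q : q \in A -> q \in darts by move=> /AE; rewrite inE => /andP[].
by case/orP=> /ED ->; rewrite ?orbT.
Qed.

Lemma symc_inj : {in powerset edges &, injective symc}.
Proof.
move=> A B; rewrite !powersetE => AE BE AB.
have E (X : {set dart}) : X \subset edges -> X = symc X :&: edges.
  move=> /subsetP XE; apply/setP => p; rewrite in_setI inE.
  case pX: (p \in X); rewrite /= ?(XE p pX) //; apply/esym/negP => /andP[/XE].
  by rewrite !inE /= => /andP[_ lt] /andP[_]; rewrite ltnNge ltnW.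
by rewrite (E A AE) (E B BE) AB.
Qed.

(** Edge sets with the same boundary differ by a circulation. *)
Lemma card_edge_sets : 2 ^ #|edges| <= 2 ^ #|verts| * #|circulations|.
Proof.
rewrite -!card_powerset -cardsX.
(* [A] is recovered from its boundary and a circulation. *)
pose phi (A : {set dart}) := (bdry A, [set p | (p \in symc A) (+) (p \in symc (rep (bdry A)))]).
rewrite -(@card_in_imset _ _ phi) => [|A B AE BE [bE xE]]; last first.
  apply: symc_inj => //; apply/setP => p; move/setP/(_ p): xE; rewrite !in_set bE.
  by move/addIb.
apply/subset_leq_card/subsetP => q /imsetP[A]; rewrite powersetE => AE ->{q}.
rewrite in_setX powersetE inE /=; apply/andP; split; [|apply/and3P; split].
- apply/subsetP => x; rewrite !in_set; apply: contraLR; rewrite -leqNgt leqn0 => dx.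
  rewrite big1 // => y _; apply/negP => /(symc_darts AE); rewrite inE /= => xy.
  by move: dx; apply/negP; rewrite -lt0n; apply/card_gt0P; exists y; rewrite inE.
- apply/subsetP => p; rewrite in_set; case pA: (p \in symc A) => /=.
    by move=> _; apply: symc_darts pA.
  by apply: symc_darts; apply: rep_sub.
- by apply/forallP => p; rewrite !in_set flipK ![(flip p \in _) || _]orbC.
apply/forallP => x; apply/eqP; under eq_bigr => y _ do rewrite in_set.
rewrite big_split /=; have := congr1 (fun S : {set T} => x \in S) (rep_bdry AE).
by rewrite !in_set => ->; rewrite addbb.
Qed.

(** Circulations are at least [2 ^ (E - V)] in number because the fibres of the
    boundary map are their translates, and at most [2 ^ (F - 1)] because each is the
    differential of a potential. *)
Theorem euler : darts != set0 -> #|edges| < #|verts| + #|faces|.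
Proof.
case/set0Pn=> p0 p0D.
have f0 : 0 < #|faces| by apply/card_gt0P; exists (face p0); apply: imset_f.
have : 2 ^ #|edges| <= 2 ^ (#|verts| + #|faces|.-1).
  by rewrite expnD; apply: leq_trans card_edge_sets _; rewrite leq_mul2l (card_circulations p0D) orbT.
by rewrite leq_exp2l //; lia.
Qed.

Theorem short_cycle : (exists x y, e x y) -> (forall x, deg e x <= 3) ->
  (forall x, deg e x != 1) ->
  exists c, [/\ ucycle e c, 2 < size c & count (fun x => deg e x == 3) c <= 5].
Proof.
move=> [x0 [y0 xy0]] d3 d1; have [//|no] := pselect (exists c, [/\ ucycle e c, 2 < size c & count (fun x => deg e x == 3) c <= 5]).
have hc c : ucycle e c -> 2 < size c -> 6 <= count (fun x => deg e x == 3) c.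
  by move=> cc sc; rewrite ltnNge; apply/negP => hc; apply: no; exists c.
have D0 : darts != set0 by apply/set0Pn; exists (x0, y0); rewrite inE.
have := euler D0; have := faces_heavy hc; rewrite (card_darts (fun x => deg e x == 3)).
have := card_edges; have := card_darts xpredT.
rewrite (_ : [set q in darts | _] = darts); last by apply/setP => p; rewrite in_set andbT.
move=> ->; rewrite (bigID (fun x => deg e x == 3)) /=.
rewrite (eq_bigr (fun=> 3)) => [|x /eqP//]; rewrite sum_nat_const.
rewrite (bigID (fun x => deg e x == 2)) /= [X in _ + (_ + X)]big1; last first.
  by move=> x /andP[]; have := d3 x; have := d1 x; case: (deg e x) => [|[|[|[|]]]].
rewrite (eq_bigl (fun x => deg e x == 2)) => [|x]; last by case: eqP => [->|].
rewrite (eq_bigr (fun=> 2)) => [|x /eqP//]; rewrite sum_nat_const.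
have -> : #|verts| = #|[pred x | deg e x == 3]| + #|[pred x | deg e x == 2]|.
  rewrite -cardUI addnC (eq_card0 (A := [predI _ & _])) ?add0n.
    apply: eq_card => x; rewrite !inE; have := d3 x; have := d1 x.
    by case: (deg e x) => [|[|[|[|]]]].
  by move=> x; rewrite !inE; case: eqP => [->|].
set V3 := #|_|; set V2 := #|_|.
lia.
Qed.
End Euler.

(** * Cyclic orders *)

Section CyclicNext.
Variables (T : finType) (N : {set T}) (lt : rel T).
Hypothesis lt_irr : {in N, forall x, ~~ lt x x}.
Hypothesis lt_total : {in N &, forall x y, x != y -> lt x y (+) lt y x}.
Hypothesis lt_trans : {in N & &, forall y x z, lt x y -> lt y z -> lt x z}.

Lemma minimal_elt (A : {set T}) t0 : A \subset N -> t0 \in A ->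
  exists2 t, t \in A & {in A, forall k, ~~ lt k t}.
Proof.
move=> /subsetP AN t0A; pose below t := [set k in A | lt k t].
case: (@arg_minnP _ t0 (mem A) (fun t => #|below t|) t0A) => t tA tmin.
exists t => // k kA; apply/negP => kt; have := tmin k kA; rewrite leqNgt => /negP[].
apply: proper_card; apply/properP; split.
  apply/subsetP => m; rewrite !inE => /andP[mA mk]; rewrite mA.
  exact: lt_trans (AN _ kA) (AN _ mA) (AN _ tA) mk kt.
by exists k; rewrite !inE kA ?kt // (negPf (lt_irr (AN _ kA))).
Qed.

(** The successor of the last element is the first one. *)
Definition is_next s t := (t \in N) &&
  (if [exists k in N, lt s k] then lt s t && [forall k in N, lt s k ==> ~~ lt k t]
   else [forall k in N, ~~ lt k t]).

Lemma is_next_ex s : s \in N -> exists t, is_next s t.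
Proof.
move=> sN; rewrite /is_next.
case: (boolP [exists k in N, lt s k]) => [/existsP[k /andP[kN sk]]|_].
  have [||t] := @minimal_elt [set k in N | lt s k] k.
  - by apply/subsetP => m; rewrite inE => /andP[].
  - by rewrite inE kN.
  rewrite inE => /andP[tN st] tmin; exists t; rewrite tN st /=.
  apply/forall_inP => m mN; apply/implyP => sm; apply: tmin.
  by rewrite inE mN.
have [t tN tmin] := minimal_elt (subxx N) sN.
by exists t; rewrite tN; apply/forall_inP.
Qed.

Lemma is_next_neq s t : s \in N -> 1 < #|N| -> is_next s t -> t != s.
Proof.
move=> sN N1 /andP[tN]; case: ifP => [_ /andP[st _]|/negbT noex /forall_inP tmin].
  by apply: contraTneq st => ->; apply: lt_irr.
apply: contraTneq N1 => ts; rewrite -leqNgt -(cards1 s).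
apply/subset_leq_card/subsetP => k kN; rewrite inE; apply/negPn/negP => ks.
have := lt_total kN sN ks; rewrite -{1}ts (negPf (tmin k kN)) /=.
apply/negP; apply: contra noex => sk.
by apply/existsP; exists k; rewrite kN.
Qed.

(** Passing from [s] to its successor adds [s] to the elements before; at the
    end of the cycle all elements of [z] are dropped, an even number. *)
Lemma is_next_parity s t (z : pred T) : s \in N -> is_next s t ->
  (forall k, z k -> k \in N) -> \big[addb/false]_k z k = false ->
  \big[addb/false]_(k | z k) lt k t = (\big[addb/false]_(k | z k) lt k s) (+) z s.
Proof.
move=> sN /andP[tN nst] zN ev.
have zs : \big[addb/false]_(k | z k) (k == s) = z s.
  case zs: (z s); last by rewrite big1 // => k zk; apply: contraFF zs => /eqP <-.
  by rewrite (bigD1 s) //= eqxx big1 // => k /andP[_ /negPf].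
rewrite -{}zs -big_split /=; move: nst; case: ifP => [_|/negbT noex].
  move=> /andP[st /forall_inP nb]; apply: eq_bigr => k zk.
  have kN := zN k zk; have [->|ks] := eqVneq k s.
    by rewrite st (negPf (lt_irr sN)).
  rewrite addbF; have := lt_total kN sN ks; case ks': (lt k s) => /= sk.
    exact: lt_trans sN kN tN ks' st.
  by have := nb k kN; rewrite sk /= => /negPf.
move=> /forall_inP tmin; rewrite big1 => [|k /zN kN]; last exact/negbTE/tmin.
rewrite -[LHS]ev [RHS]big_mkcond /=; apply: eq_bigr => k _; case zk: (z k) => //.
have kN := zN k zk; have [->|ks] := eqVneq k s; first by rewrite (negPf (lt_irr sN)).
have := lt_total kN sN ks; case: (lt k s) => //= sk.
by case/negP: noex; apply/existsP; exists k; rewrite kN.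
Qed.
End CyclicNext.

(** * Crossing parities of a family of segments *)

Import Order.TTheory GRing.Theory Num.Theory.
Local Open Scope ring_scope.

(** A strict change of sign would produce a zero strictly in between. *)
Lemma affine_sign (R : realFieldType) (p q lo hi : R) : lo < hi ->
  (forall x, lo < x < hi -> p + q * x != 0) ->
  (forall x, lo <= x <= hi -> 0 <= p + q * x) \/
  (forall x, lo <= x <= hi -> p + q * x <= 0).
Proof.
move=> lohi nz; have [l0|l0] := lerP 0 (p + q * lo); have [h0|h0] := lerP 0 (p + q * hi).
- by left=> x /andP[lx xh]; nra.
- have [leq0|lne] := eqVneq (p + q * lo) 0.
    by right=> x /andP[lx xh]; nra.
  have l1 : 0 < p + q * lo by rewrite lt_def lne.
  have q1 : q < 0 by nra.
  have qx : q * (- p / q) = - p by field; rewrite lt_eqF.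
  suff H : lo < - p / q < hi by have := nz _ H; rewrite qx subrr eqxx.
  by apply/andP; split; rewrite -(ltr_nM2l q1) qx; lra.
- have [heq0|hne] := eqVneq (p + q * hi) 0.
    by right=> x /andP[lx xh]; nra.
  have h1 : 0 < p + q * hi by rewrite lt_def hne.
  have q1 : 0 < q by nra.
  have qx : q * (- p / q) = - p by field; rewrite gt_eqF.
  suff H : lo < - p / q < hi by have := nz _ H; rewrite qx subrr eqxx.
  by apply/andP; split; rewrite -(ltr_pM2l q1) qx; lra.
- by right=> x /andP[lx xh]; nra.
Qed.

Section Segments.
Variable R : realFieldType.
Variables (J : finType) (P : pred J) (a b : J -> R * R).

Definition slope j := ((b j).2 - (a j).2) / ((b j).1 - (a j).1).
Definition height j x := (a j).2 + slope j * (x - (a j).1).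

Hypothesis ab : forall j, P j -> (a j).1 < (b j).1.
(** Stated in one direction only; exchanging [j] and [t] gives the ends of [t]. *)
Hypothesis noncross : forall j t x, P j -> P t -> j != t ->
  (a j).1 <= x <= (b j).1 -> (a t).1 <= x <= (b t).1 ->
  height j x = height t x -> x = (a j).1 \/ x = (b j).1.

Lemma height_a j : height j (a j).1 = (a j).2.
Proof. by rewrite /height subrr mulr0 addr0. Qed.

Lemma height_b j : P j -> height j (b j).1 = (b j).2.
Proof.
by move=> /ab lt; rewrite /height /slope mulfVK ?subr_eq0 ?gt_eqF // addrC subrK.
Qed.

Lemma pairE (p q : R * R) : (p == q) = (p.1 == q.1) && (p.2 == q.2).
Proof. by rewrite -xpair_eqE -!surjective_pairing. Qed.

Definition common j t x := ((a j).1 <= x <= (b j).1) && ((a t).1 <= x <= (b t).1).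

Lemma separated j t : P j -> P t -> j != t -> (a j).1 < (b t).1 -> (a t).1 < (b j).1 ->
  (forall x, common j t x -> height j x <= height t x) \/
  (forall x, common j t x -> height t x <= height j x).
Proof.
move=> Pj Pt jt jt1 tj1; have jj := ab Pj; have tt := ab Pt.
(* The spans overlap in [lo, hi]. *)
pose lo := Num.max (a j).1 (a t).1; pose hi := Num.min (b j).1 (b t).1.
have lohi : lo < hi by rewrite lt_min !gt_max jj tt jt1 tj1.
pose p := height t 0 - height j 0; pose q := slope t - slope j.
have dE x : p + q * x = height t x - height j x by rewrite /p /q /height; ring.
have cE x : common j t x = (lo <= x <= hi).
  by rewrite /common ge_max le_min; case: (_ <= x); case: (_ <= x); rewrite ?andbF.
case: (affine_sign (p := p) (q := q) lohi) => [x|H|H].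
- rewrite lt_min gt_max => /andP[/andP[l1 l2] /andP[h1 h2]]; rewrite dE subr_eq0.
  apply/negP => /eqP eqh; have [||xE|xE] := noncross Pj Pt jt _ _ (esym eqh).
  + by rewrite !ltW.
  + by rewrite !ltW.
  + by rewrite xE ltxx in l1.
  + by rewrite xE ltxx in h1.
- by left=> x; rewrite cE => /H; rewrite dE subr_ge0.
- by right=> x; rewrite cE => /H; rewrite dE subr_le0.
Qed.

Lemma slope_neq_a j t : P j -> P t -> j != t -> a j = a t -> slope j != slope t.
Proof.
move=> Pj Pt jt aE; apply/eqP => sE.
have jj := ab Pj; have tt := ab Pt.
pose hi := Num.min (b j).1 (b t).1.
have lohi : (a j).1 < hi by rewrite lt_min jj aE tt.
have hE : hi <= (b j).1 /\ hi <= (b t).1 by rewrite !ge_min !lexx orbT.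
have [|||xE|xE] := @noncross j t (((a j).1 + hi) / 2) Pj Pt jt.
- by apply/andP; split; clear aE sE; lra.
- by rewrite -aE; apply/andP; split; clear aE sE; lra.
- by rewrite /height sE aE.
- by clear aE sE; lra.
- by clear aE sE; lra.
Qed.

Lemma slope_neq_b j t : P j -> P t -> j != t -> b j = b t -> slope j != slope t.
Proof.
move=> Pj Pt jt bE; apply/eqP => sE.
have jj := ab Pj; have tt := ab Pt.
pose lo := Num.max (a j).1 (a t).1.
have lohi : lo < (b j).1 by rewrite gt_max jj bE tt.
have hE : (a j).1 <= lo /\ (a t).1 <= lo by rewrite !le_max !lexx orbT.
have hb k : P k -> forall x, height k x = (b k).2 - slope k * ((b k).1 - x).
  by move=> Pk x; rewrite -(height_b Pk) /height; ring.
have [|||xE|xE] := @noncross j t (((b j).1 + lo) / 2) Pj Pt jt.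
- by apply/andP; split; clear bE sE; lra.
- by rewrite -bE; apply/andP; split; clear bE sE; lra.
- by rewrite !hb // sE bE.
- by clear bE sE; lra.
- by clear bE sE; lra.
Qed.

Lemma slope_lt_a j t : P j -> P t -> j != t -> a j = a t ->
  (forall x, common j t x -> height j x <= height t x) -> slope j < slope t.
Proof.
move=> Pj Pt jt aE le; rewrite lt_def (slope_neq_a Pt Pj) // 1?eq_sym //=.
have jj := ab Pj; have tt := ab Pt.
pose hi := Num.min (b j).1 (b t).1.
have lohi : (a j).1 < hi by rewrite lt_min jj aE tt.
have hE : hi <= (b j).1 /\ hi <= (b t).1 by rewrite !ge_min !lexx orbT.
have := le hi; rewrite /common -aE (ltW lohi) hE.1 hE.2 => /(_ isT).
by rewrite /height aE lerD2l ler_pM2r // subr_gt0 -aE.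
Qed.

Lemma slope_lt_b j t : P j -> P t -> j != t -> b j = b t ->
  (forall x, common j t x -> height j x <= height t x) -> slope t < slope j.
Proof.
move=> Pj Pt jt bE le; rewrite lt_def (slope_neq_b Pj Pt) //=.
have jj := ab Pj; have tt := ab Pt.
pose lo := Num.max (a j).1 (a t).1.
have lohi : lo < (b j).1 by rewrite gt_max jj bE tt.
have hE : (a j).1 <= lo /\ (a t).1 <= lo by rewrite !le_max !lexx orbT.
have := le lo; rewrite /common -bE (ltW lohi) hE.1 hE.2 => /(_ isT).
have hb k : P k -> forall x, height k x = (b k).2 - slope k * ((b k).1 - x).
  by move=> Pk x; rewrite -(height_b Pk) /height; ring.
by rewrite !hb // bE lerD2l lerN2 ler_pM2r // subr_gt0 -bE.
Qed.

Definition lies_over t (p : R * R) := [&& (a t).1 <= p.1, p.1 < (b t).1 & p.2 < height t p.1].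
Definition incident p t := (a t == p) || (b t == p).
(** Clockwise order of the segments at [p], starting from the upward vertical:
    first those that go right from [p], then those that go left, each group by
    decreasing slope. *)
Definition before p t s :=
  if a t == p then (a s == p) ==> (slope s < slope t)
  else (a s != p) && (slope s < slope t).
(** The points above the segment [j] and its right end.  This choice turns the
    left side of [crossing_parity] into a sum over the ends of [t]. *)
Definition beyond j (q : R * R) :=
  [&& (a j).1 < q.1, q.1 <= (b j).1 & (height j q.1 < q.2) || (q == b j)].

(** For [t] different from [j], if the spans of [t] and [j] overlap then [t]
    lies above or below [j] over the whole overlap.  If above, [t] is counted at
    the left end of [j] when it starts before [j], at the right end when it ends
    after [j], and its own ends are counted in the complementary cases.  If
    below, [t] matters only when both end at the same point. *)
Lemma crossing_parity j t : P j -> P t ->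
  (lies_over t (a j) (+) (incident (a j) t && before (a j) t j)) (+)
  (lies_over t (b j) (+) (incident (b j) t && before (b j) t j)) (+) (t == j) =
  beyond j (a t) (+) beyond j (b t).
Proof.
move=> Pj Pt; have jj := ab Pj; have tt := ab Pt.
have abN : a j == b j = false by rewrite pairE lt_eqF.
rewrite /before eqxx abN /=.
have -> : incident (a j) t && (if a t == a j then slope j < slope t else false) =
    (a t == a j) && (slope j < slope t).
  by rewrite /incident; case: (a t == a j); rewrite ?andbF.
have -> : incident (b j) t && (if a t == b j then true else slope j < slope t) =
    (a t == b j) || (b t == b j) && (slope j < slope t).
  by rewrite /incident; case: (a t == b j).
have [->|tj] := eqVneq t j.
  rewrite /lies_over /beyond !ltxx abN height_a !lexx !eqxx !ltxx !andbF /= orbT.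
  by rewrite jj.
rewrite addbF; have jt : j != t by rewrite eq_sym.
have [ltjt|letj] := ltP (a j).1 (b t).1; last first.
  have lt1 : (b j).1 < (b t).1 = false by apply/negbTE; rewrite -leNgt; lra.
  have lt2 : (a j).1 < (a t).1 = false by apply/negbTE; rewrite -leNgt; lra.
  have lt3 : (a j).1 < (b t).1 = false by apply/negbTE; rewrite -leNgt.
  rewrite /lies_over /beyond lt1 lt2 lt3 !andbF !pairE.
  rewrite [(a t).1 == (a j).1]lt_eqF ?[(a t).1 == (b j).1]lt_eqF ?[(b t).1 == (b j).1]lt_eqF //; lra.
have [lttj|lejt] := ltP (a t).1 (b j).1; last first.
  have lt1 : (a t).1 <= (a j).1 = false by apply/negbTE; rewrite -ltNge; lra.
  have lt2 : (b t).1 <= (b j).1 = false by apply/negbTE; rewrite -ltNge; lra.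
  have lt3 : (b j).1 < (b t).1 by lra.
  have lt4 : (a j).1 < (a t).1 by lra.
  rewrite /lies_over /beyond lt1 lt2 lt3 lt4 /= andbF !pairE [(a t).1 == (a j).1]gt_eqF //.
  rewrite [(b t).1 == _]gt_eqF //= orbF addbF.
  have [leE|ltE] := lerP (a t).1 (b j).1; last by rewrite gt_eqF.
  have E : (a t).1 = (b j).1 by lra.
  rewrite E eqxx -[in height t _]E height_a height_b //=.
  by case: ltgtP.
have atbj : a t == b j = false by rewrite pairE lt_eqF.
have cE x : common j t x = common t j x by rewrite /common andbC.
rewrite atbj /=.
have [le|ge] := separated Pj Pt jt ltjt lttj.
  have -> : lies_over t (a j) (+) (a t == a j) && (slope j < slope t) = ((a t).1 <= (a j).1).
    rewrite /lies_over ltjt /=; have [leA|ltA] := lerP (a t).1 (a j).1; last first.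
      by rewrite pairE gt_eqF.
    have c : common j t (a j).1 by rewrite /common lexx leA !ltW.
    have := le _ c; rewrite height_a le_eqVlt => /predU1P[hE|hlt].
      case: (noncross Pt Pj tj _ _ (x := (a j).1)); rewrite ?lexx ?leA ?ltW // ?height_a //.
        move=> AE; have aE : a t == a j by rewrite pairE AE eqxx -height_a -AE -hE /=.
        by rewrite -hE ltxx aE (slope_lt_a Pj Pt jt _ le) // (eqP aE).
      by move=> BE; rewrite BE ltxx in ltjt.
    rewrite hlt; case: eqP => //= aE; move: hlt; rewrite -aE height_a ltxx //.
  have -> : lies_over t (b j) (+) (b t == b j) && (slope j < slope t) = ((b j).1 < (b t).1).
    rewrite /lies_over (ltW lttj) /=; have [ltB|leB] := ltP (b j).1 (b t).1; last first.
      case: eqP => //= bE; apply/negbTE; rewrite -leNgt ltW //.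
      exact: slope_lt_b.
    rewrite pairE gt_eqF // addbF /=.
    have c : common j t (b j).1 by rewrite /common lexx !ltW.
    have := le _ c; rewrite height_b // le_eqVlt => /predU1P[hE|//].
    case: (noncross Pt Pj tj _ _ (x := (b j).1)); rewrite ?lexx ?ltW // ?height_b //.
      by move=> BE; rewrite BE ltxx in lttj.
    by move=> BE; rewrite BE ltxx in ltB.
  have -> : beyond j (a t) = ((a j).1 < (a t).1).
    rewrite /beyond (ltW lttj) atbj orbF /=; have [ltA|//] := ltP (a j).1 (a t).1.
    have c : common j t (a t).1 by rewrite /common lexx !ltW.
    have := le _ c; rewrite height_a le_eqVlt => /predU1P[hE|//].
    case: (noncross Pj Pt jt _ _ (x := (a t).1)); rewrite ?lexx ?ltW // ?height_a //.
      by move=> AE; rewrite AE ltxx in ltA.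
    by move=> AE; rewrite AE ltxx in lttj.
  have -> : beyond j (b t) = ((b t).1 <= (b j).1).
    rewrite /beyond ltjt /=; have [leB|//] := leP (b t).1 (b j).1.
    have c : common j t (b t).1 by rewrite /common lexx leB !ltW.
    have := le _ c; rewrite height_b // le_eqVlt => /predU1P[hE|->//].
    case: (noncross Pj Pt jt _ _ (x := (b t).1)); rewrite ?lexx ?leB ?ltW // ?height_b //.
      by move=> BE; rewrite BE ltxx in ltjt.
    move=> BE; rewrite pairE BE eqxx -(height_b Pj) -BE hE eqxx orbT //.
  by rewrite !ltNge; case: (_ <= _); case: (_ <= _).
have -> : lies_over t (a j) (+) (a t == a j) && (slope j < slope t) = false.
  rewrite /lies_over ltjt /=; have [leA|ltA] := lerP (a t).1 (a j).1; last first.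
    by rewrite pairE gt_eqF.
  have c : common j t (a j).1 by rewrite /common lexx leA !ltW.
  have := ge _ c; rewrite height_a leNgt => /negPf -> /=.
  case: eqP => //= aE; apply/negbTE; rewrite -leNgt ltW //.
  by apply: slope_lt_a => // x; rewrite -cE => /ge.
have -> : lies_over t (b j) (+) (b t == b j) && (slope j < slope t) = (b t == b j).
  rewrite /lies_over (ltW lttj) /=; have [ltB|leB] := ltP (b j).1 (b t).1; last first.
    case: eqP => //= bE; apply: slope_lt_b => // x; rewrite -cE => /ge //.
  rewrite pairE gt_eqF // addbF /=.
  have c : common j t (b j).1 by rewrite /common lexx !ltW.
  by have := ge _ c; rewrite height_b // leNgt => /negPf.
have -> : beyond j (a t) = false.
  rewrite /beyond (ltW lttj) atbj orbF /=; have [ltA|//] := ltP (a j).1 (a t).1.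
  have c : common j t (a t).1 by rewrite /common lexx !ltW.
  by have := ge _ c; rewrite height_a leNgt => /negPf.
rewrite /beyond ltjt /=; have [leB|ltB] := leP (b t).1 (b j).1; last by rewrite pairE gt_eqF.
have c : common j t (b t).1 by rewrite /common lexx leB !ltW.
by have := ge _ c; rewrite height_b // leNgt => /negPf ->.
Qed.

Definition upward (z : pred J) p := \big[addb/false]_(t | P t && z t) lies_over t p.
(** The parity of [z] in the sector at [p] to the left of the segment [s] seen
    from [p], that is just before [s] in clockwise order: the segments above [p]
    are met first, then those at [p] that come before [s]. *)
Definition side (z : pred J) p s := upward z p (+)
  \big[addb/false]_(t | P t && z t) (incident p t && before p t s).

(** Every point is an end of an even number of segments of [z]; summing an
    arbitrary weight over all ends avoids listing the points. *)
Definition balanced (z : pred J) := forall f : pred (R * R),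
  \big[addb/false]_(t | P t && z t) (f (a t) (+) f (b t)) = false.

(** The two ends of [j] see its two opposite sides; this is [crossing_parity]
    summed over [z]. *)
Lemma side_ends z j : P j -> balanced z -> side z (a j) j (+) side z (b j) j = z j.
Proof.
move=> Pj bz; have := bz (beyond j).
under eq_bigr => t /andP[Pt _] do rewrite -(crossing_parity Pj Pt).
rewrite !big_split /=.
have -> : \big[addb/false]_(t | P t && z t) (t == j) = z j.
  case zj: (z j); last by rewrite big1 // => t /andP[_ zt]; apply: contraFF zj => /eqP <-.
  by rewrite (bigD1 j) ?Pj //= eqxx big1 // => t /andP[_ /negPf].
rewrite -/(upward z (a j)) -/(upward z (b j)) -/(side z (a j) j) -/(side z (b j) j).
by case: (z j); rewrite ?addbT ?addbF // => /negbFE.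
Qed.

Lemma before_irr p t : ~~ before p t t.
Proof. by rewrite /before ltxx implybF andbF; case: ifP => // ->. Qed.

Lemma before_total p t s : P t -> P s -> incident p t -> incident p s -> t != s ->
  before p t s (+) before p s t.
Proof.
move=> Pt Ps it is_ ts; rewrite /before.
have st : s != t by rewrite eq_sym.
move: it is_; rewrite /incident; case: (eqVneq (a t) p) => [at_|nat_] /=;
  case: (eqVneq (a s) p) => [as_|nas_] //=.
  move=> _ _; have := slope_neq_a Pt Ps ts; rewrite at_ as_ => /(_ erefl).
  by case: ltgtP.
move=> /eqP bt /eqP bs; have := slope_neq_b Pt Ps ts; rewrite bt bs => /(_ erefl).
by case: ltgtP.
Qed.

Lemma before_trans p t s r : before p s t -> before p t r -> before p s r.
Proof.
rewrite /before; case: (a s == p) => /=; case: (a t == p) => /=; case: (a r == p) => //= st tr;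
  exact: lt_trans tr st.
Qed.

Lemma side_incident z p s : side z p s = upward z p (+)
  \big[addb/false]_(t | P t && incident p t) (z t && before p t s).
Proof.
congr addb; rewrite big_mkcond [RHS]big_mkcond /=; apply: eq_bigr => t _.
by case: (P t); case: (z t); case: (incident p t).
Qed.

(** At a point of degree two, the side left of one segment is the side right of
    the other. *)
Lemma side_straight z p s t : P s -> P t -> s != t ->
  (forall r, P r && incident p r = (r == s) || (r == t)) -> z s = z t ->
  side z p s (+) side z p t = z s.
Proof.
move=> Ps Pt st inc zst; rewrite !side_incident.
have E q : \big[addb/false]_(r | P r && incident p r) (z r && before p r q) =
    (z s && before p s q) (+) (z t && before p t q).
  rewrite (eq_bigl (fun r => r \in [set s; t])) => [|r]; last by rewrite inc !inE.
  by rewrite big_setU1 ?inE //= big_set1.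
rewrite !E zst (negPf (before_irr p s)) (negPf (before_irr p t)) andbF addbF.
have [/andP[_ is_] /andP[_ it]] : P s && incident p s /\ P t && incident p t.
  by rewrite !inc !eqxx orbT.
have := before_total Ps Pt is_ it st.
by case: (upward z p); case: (z t); case: (before p s t); case: (before p t s).
Qed.
End Segments.

(** * Plane drawings *)

Section Coordinates.
Variable R : realType.
Local Notation point := ('rV[R]_2).

(** A shear: for suitable [c] no segment of the drawing is vertical. *)
Definition coord (c : R) (p : point) : R * R := (p 0 0 + c * p 0 1, p 0 1).

Lemma coord_inj c : injective (coord c).
Proof.
move=> p q [e0 e1]; rewrite e1 in e0; move/addIr: e0 => e0.
apply/rowP => i; have [->|->//] : i = 0 \/ i = 1.
  by case: i => [[|[|//]] i2]; [left|right]; apply: val_inj.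
by [].
Qed.

Lemma segment_sym (p q : point) z : segment p q z -> segment q p z.
Proof.
case=> t /andP[t0 t1] ->; exists (1 - t); first by apply/andP; split; lra.
by rewrite subKr addrC.
Qed.

Lemma segment_l (p q : point) : segment p q p.
Proof. by exists 0; rewrite ?lexx ?ler01 // subr0 scale1r scale0r addr0. Qed.

Lemma segment_r (p q : point) : segment p q q.
Proof. exact/segment_sym/segment_l. Qed.

Lemma segment_at c (p q : point) x : (coord c p).1 < (coord c q).1 ->
  (coord c p).1 <= x <= (coord c q).1 ->
  exists2 z, segment p q z & coord c z = (x, (coord c p).2 +
    ((coord c q).2 - (coord c p).2) / ((coord c q).1 - (coord c p).1) * (x - (coord c p).1)).
Proof.
move=> pq /andP[px xq]; set D := (coord c q).1 - (coord c p).1.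
have D0 : 0 < D by rewrite subr_gt0.
pose t := (x - (coord c p).1) / D.
exists ((1 - t) *: p + t *: q).
  exists t => //; apply/andP; split; first by rewrite divr_ge0 ?subr_ge0 // ltW.
  by rewrite ler_pdivrMr // mul1r lerD2r.
have E : t * D = x - (coord c p).1 by rewrite mulfVK // gt_eqF.
rewrite {1}/coord !mxE; congr pair.
  by rewrite -[RHS](subrK (coord c p).1) -E /D /coord /=; ring.
by rewrite -E [t * D]mulrC mulrA divfK ?gt_eqF // /coord /=; ring.
Qed.

(** Each pair of points excludes at most one value of [c]. *)
Lemma generic_direction (I : eqType) (s : seq I) (f g : I -> point) :
  (forall i, i \in s -> f i != g i) ->
  exists c, forall i, i \in s -> (coord c (f i)).1 != (coord c (g i)).1.
Proof.
move=> fg; (* At [c = bad i] the two points of the pair [i] get the same abscissa. *)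
pose bad i := - (f i 0 0 - g i 0 0) / (f i 0 1 - g i 0 1).
exists (1 + \sum_(i <- s) `|bad i|) => i si; set c := 1 + _.
have lt_c : `|bad i| < c.
  rewrite /c (perm_big _ (perm_to_rem si)) big_cons addrA [1 + _]addrC -addrA ltrDl.
  by apply: ltr_pwDl => //; apply: sumr_ge0.
apply/eqP => /= eqc; have fgi := fg i si.
have [e1|n1] := eqVneq (f i 0 1) (g i 0 1).
  case/eqP: fgi; apply: (@coord_inj 0); rewrite /coord e1; congr pair.
  by move: eqc; rewrite e1; lra.
have : bad i = c.
  by apply: (mulIf (x := f i 0 1 - g i 0 1)); rewrite ?subr_eq0 // mulfVK ?subr_eq0 //; lra.
by move=> bc; move: lt_c; rewrite bc ltNge ler_norm.
Qed.
End Coordinates.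

Section Drawing.
Variables (R : realType) (G : sgraph) (pos : G -> 'rV[R]_2) (arc : G -> G -> seq 'rV[R]_2).
Hypothesis dr : plane_drawing pos arc.
Variable e : rel G.
Hypotheses (es : symmetric e) (eadj : subrel e (@adj G)).

Local Notation rk := enum_rank.
Let ei : irreflexive e.
Proof. by move=> x; apply/negP => /eadj; rewrite adj_irrefl. Qed.

Section Arc.
Variables x y : G.
Hypothesis xy : e x y.
Let s := arc x y.

Lemma arc_size : (1 < size s)%N.
Proof. by case: (arc_polygonal dr (eadj xy)). Qed.

Lemma arc_first : s`_0 = pos x.
Proof. by case: (arc_polygonal dr (eadj xy)). Qed.

Lemma arc_last : s`_(size s).-1 = pos y.
Proof. by rewrite nth_last; case: (arc_polygonal dr (eadj xy)). Qed.

Lemma arc_uniq : uniq s.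
Proof. by case: (arc_polygonal dr (eadj xy)). Qed.

Lemma arc_nth_eq i j : (i < size s)%N -> (j < size s)%N -> (s`_i == s`_j) = (i == j).
Proof. by move=> is_ js; apply: nth_uniq => //; apply: arc_uniq. Qed.

Lemma arc_cross i j z : (i < j)%N -> (j.+1 < size s)%N ->
  segment s`_i s`_i.+1 z -> segment s`_j s`_j.+1 z -> j = i.+1 /\ z = s`_j.
Proof. by case: (arc_polygonal dr (eadj xy)) => _ _ _ _; apply. Qed.

Lemma arc_polyline i z : (i.+1 < size s)%N -> segment s`_i s`_i.+1 z -> polyline s z.
Proof. by exists i. Qed.

Lemma arc_node i : (i < size s)%N -> polyline s s`_i.
Proof.
case: i => [_|i si]; first by exists 0%N; [exact: arc_size|apply: segment_l].
by exists i => //; apply: segment_r.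
Qed.

(** The end vertices are on the first and the last segment, and these meet
    other segments only in break points. *)
Lemma arc_end_node i z : (i.+1 < size s)%N -> segment s`_i s`_i.+1 z ->
  z = pos x \/ z = pos y -> z = s`_i \/ z = s`_i.+1.
Proof.
move=> si zi [zE|zE].
  case: i si zi => [|i] si zi; first by left; rewrite zE -arc_first.
  have s0 : segment s`_0 s`_1 z by rewrite zE -arc_first; apply: segment_l.
  have [iE zE'] := arc_cross (ltn0Sn i) si s0 zi.
  by left.
have n2 : ((size s).-2.+1 < size s)%N by have := arc_size; case: (size s) => [|[|]].
have nE : (size s).-2.+1 = (size s).-1 by have := arc_size; case: (size s) => [|[|]].
have [iE|iN] := eqVneq i (size s).-2; first by right; rewrite zE -arc_last iE nE.
have lt : (i < (size s).-2)%N by move: iN si arc_size; lia.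
have sl : segment s`_(size s).-2 s`_(size s).-2.+1 z.
  by rewrite zE nE -arc_last; apply: segment_r.
have [jE zE'] := arc_cross lt n2 zi sl.
by right; rewrite zE' jE.
Qed.
End Arc.

Lemma arcs_meet x y x' y' z : e x y -> e x' y' -> (rk x < rk y)%N -> (rk x' < rk y')%N ->
  (x, y) != (x', y') -> polyline (arc x y) z -> polyline (arc x' y') z ->
  z = pos x \/ z = pos y.
Proof.
move=> xy xy' lt lt' ne; apply: (arc_disjoint dr (eadj xy) (eadj xy')).
apply: contra ne => /eqP/setP E.
have := E x; have := E y; rewrite !inE !eqxx ?orbT /=.
have yx : (y == x) = false by apply/eqP => yx; rewrite yx ltnn in lt.
move=> /esym/orP[]/eqP yE /esym/orP[]/eqP xE; subst.
- by rewrite eqxx in yx.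
- by move: lt lt'; rewrite ltnNge => /negP h /ltnW.
- by rewrite eqxx.
- by rewrite eqxx in yx.
Qed.

Section Pieces.
Definition bound : nat := \max_(p : G * G) size (arc p.1 p.2).
Definition piece := (G * G * 'I_bound.+1)%type.
Local Notation curve j := (arc j.1.1 j.1.2).

Definition valid (j : piece) :=
  [&& e j.1.1 j.1.2, (rk j.1.1 < rk j.1.2)%N & (j.2.+1 < size (curve j))%N].
Definition tail_pt (j : piece) := (curve j)`_j.2.
Definition head_pt (j : piece) := (curve j)`_j.2.+1.

Lemma size_bound x y : (size (arc x y) <= bound)%N.
Proof. exact: (leq_bigmax (x, y)). Qed.

Lemma piece_neq (j t : piece) : j != t -> j.1 = t.1 -> (j.2 : nat) != t.2.
Proof.
case: j t => [p i] [q k] /= jt pq; apply: contraNneq jt => ik.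
by rewrite pq; apply/eqP; congr pair; apply: val_inj.
Qed.

(** On one arc by the definition of polygonal arcs; on two arcs the common
    point is a vertex, which is an end of the segment by [arc_end_node]. *)
Lemma segments_meet j t z : valid j -> valid t -> j != t ->
  segment (tail_pt j) (head_pt j) z -> segment (tail_pt t) (head_pt t) z ->
  z = tail_pt j \/ z = head_pt j.
Proof.
move=> /and3P[ej oj sj] /and3P[et ot st] jt zj zt.
have [jtE|jtN] := eqVneq j.1 t.1.
  have := piece_neq jt jtE; rewrite /tail_pt /head_pt -jtE in st zt *.
  case: ltngtP => // lt _.
    by have [tE ->] := arc_cross ej lt st zj zt; right; rewrite tE.
  by have [tE ->] := arc_cross ej lt sj zt zj; left.
apply: (arc_end_node ej sj zj).
apply: (arcs_meet ej et oj ot).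
- by rewrite -!surjective_pairing.
- exact: arc_polyline sj zj.
- exact: arc_polyline st zt.
Qed.

Variable c : R.
Hypothesis generic : forall j, valid j -> (coord c (tail_pt j)).1 != (coord c (head_pt j)).1.

Definition lft (j : piece) := if (coord c (tail_pt j)).1 < (coord c (head_pt j)).1
  then coord c (tail_pt j) else coord c (head_pt j).
Definition rgt (j : piece) := if (coord c (tail_pt j)).1 < (coord c (head_pt j)).1
  then coord c (head_pt j) else coord c (tail_pt j).

Lemma lft_rgt j : valid j -> (lft j).1 < (rgt j).1.
Proof.
by move=> /generic; rewrite /lft /rgt; case: (ltgtP (coord c (tail_pt j)).1 (coord c (head_pt j)).1).
Qed.

Lemma point_at j x : valid j -> (lft j).1 <= x <= (rgt j).1 ->
  exists2 z, segment (tail_pt j) (head_pt j) z & coord c z = (x, height lft rgt j x).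
Proof.
move=> vj; have := lft_rgt vj; rewrite /height /slope /lft /rgt.
case: ifP => _ lt xI; first exact: segment_at.
by have [z zs zE] := segment_at lt xI; exists z => //; apply: segment_sym.
Qed.

Lemma segments_noncross j t x : valid j -> valid t -> j != t ->
  (lft j).1 <= x <= (rgt j).1 -> (lft t).1 <= x <= (rgt t).1 ->
  height lft rgt j x = height lft rgt t x -> x = (lft j).1 \/ x = (rgt j).1.
Proof.
move=> vj vt jt xj xt hE; have [z zj zE] := point_at vj xj; have [z' zt zE'] := point_at vt xt.
have zz : z = z' by apply: (@coord_inj _ c); rewrite zE zE' hE.
subst z'; have xE : x = (coord c z).1 by rewrite zE.
have [zE2|zE2] := segments_meet vj vt jt zj zt; rewrite xE zE2 /lft /rgt; case: ifP => _;
  by [left|right].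
Qed.

Lemma incidentE p j : incident lft rgt (coord c p) j = (tail_pt j == p) || (head_pt j == p).
Proof.
rewrite /incident /lft /rgt; case: ifP => _; rewrite !(inj_eq (@coord_inj _ c)) //.
by rewrite orbC.
Qed.

Lemma node_end j x y : valid j -> e x y -> (tail_pt j == pos x) || (head_pt j == pos x) ->
  ((j.2 : nat) == 0%N) && (j.1.1 == x) || (j.2.+2 == size (curve j)) && (j.1.2 == x).
Proof.
move=> /and3P[ej oj sj] xy tx; have nj := arc_nth_eq ej.
have sj' := ltnW sj; have s0 : (0 < size (curve j))%N by apply: leq_ltn_trans sj'.
have sl : ((size (curve j)).-1 < size (curve j))%N by rewrite prednK.
have on : polyline (curve j) (pos x).
  by case/orP: tx => /eqP <-; [apply: arc_node sj'|apply: arc_node sj].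
have [xE|xE] := arc_vertex dr (eadj ej) on; subst x; rewrite eqxx !andbT.
  move: tx; rewrite -(arc_first ej) /tail_pt /head_pt !nj //=.
  by rewrite orbF => ->.
move: tx; rewrite -(arc_last ej) /tail_pt /head_pt !nj //= => /orP[]/eqP jE.
  by move: sj; rewrite jE prednK // ltnn.
by rewrite jE prednK // eqxx orbT.
Qed.

(** Each edge is cut into pieces in the direction of increasing rank, so that
    the first piece of a dart may be the last one of its arc; a line with [n]
    break points has [n.-1] pieces, the last of which is numbered [n.-2]. *)
Definition first_piece (x y : G) : piece :=
  if (rk x < rk y)%N then (x, y, inord 0) else (y, x, inord (size (arc y x)).-2).

Lemma edge_order x y : e x y -> (rk x < rk y)%N = false -> (rk y < rk x)%N.
Proof.
move=> xy; case: ltngtP => // /val_inj/enum_rank_inj xE.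
by move: xy; rewrite xE ei.
Qed.

Lemma last_pieceK x y : (inord (size (arc x y)).-2 : 'I_bound.+1) = (size (arc x y)).-2 :> nat.
Proof. by rewrite inordK // ltnS; have := size_bound x y; lia. Qed.

Lemma first_piece_valid x y : e x y -> valid (first_piece x y).
Proof.
move=> xy; rewrite /first_piece /valid; case: ifP => [lt|/(edge_order xy) lt] /=.
  by rewrite xy lt inordK //= (arc_size xy).
have yx : e y x by rewrite es.
by rewrite yx lt last_pieceK; have := arc_size yx; case: (size _) => [|[|n]] //= _; rewrite ltnSn.
Qed.

Lemma first_piece_incident x y : e x y -> incident lft rgt (coord c (pos x)) (first_piece x y).
Proof.
move=> xy; rewrite incidentE /first_piece /tail_pt /head_pt; case: ifP => [lt|/(edge_order xy) lt] /=.
  by rewrite inordK // (arc_first xy) eqxx.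
have yx : e y x by rewrite es.
rewrite last_pieceK -(arc_last yx); have := arc_size yx.
by case: (size _) => [|[|n]] //= _; rewrite eqxx orbT.
Qed.

Lemma incident_set x y0 : e x y0 ->
  [set j | valid j && incident lft rgt (coord c (pos x)) j] = first_piece x @: [set y | e x y].
Proof.
move=> xy0; apply/setP => j; rewrite inE; apply/andP/imsetP => [[vj]|[y]]; last first.
  by rewrite inE => xy ->; rewrite first_piece_valid // first_piece_incident.
rewrite incidentE => /(node_end vj xy0)/orP[]/andP[/eqP jE /eqP xE]; have /and3P[ej oj sj] := vj.
  exists j.1.2; first by rewrite inE -xE.
  rewrite /first_piece -xE oj; case: (j) jE => [[u v] k] /= k0.
  by congr pair; apply: val_inj; rewrite /= inordK.
exists j.1.1; first by rewrite inE -xE es.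
rewrite /first_piece -xE ltnNge (ltnW oj) /=.
case: (j) jE => [[u v] k] /= k0; congr pair; apply: val_inj.
by rewrite /= last_pieceK -k0.
Qed.

Lemma first_piece_inj x : {in [set y | e x y] &, injective (first_piece x)}.
Proof.
move=> y y'; rewrite !inE /first_piece => xy xy'.
case: ifP => l; case: ifP => l' [] //.
- by move=> xE; move: xy'; rewrite -xE ei.
- by move=> xE; move: xy; rewrite xE ei.
Qed.

Lemma break_point j : valid j -> (j.2.+2 < size (curve j))%N ->
  forall t, valid t && incident lft rgt (coord c (head_pt j)) t =
    (t == j) || (t == (j.1, inord j.2.+1)).
Proof.
move=> vj sj2 t; have /and3P[ej oj sj] := vj; rewrite incidentE.
have kE : (inord j.2.+1 : 'I_bound.+1) = j.2.+1 :> nat.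
  by rewrite inordK // ltnS; have := size_bound j.1.1 j.1.2; lia.
apply/andP/idP => [[vt]|/orP[]/eqP->]; first last.
- rewrite /valid ej oj /tail_pt /head_pt /= kE sj2 eqxx //.
- by rewrite vj eqxx orbT.
have /and3P[et ot st] := vt => tj.
have tjE : t.1 = j.1.
  apply/eqP; apply/negPn/negP => tjN.
  have [|||hE|hE] := @arcs_meet j.1.1 j.1.2 t.1.1 t.1.2 (head_pt j) ej et oj ot.
  - by rewrite -!surjective_pairing eq_sym.
  - exact: arc_node sj.
  - by case/orP: tj => /eqP <-; [apply: arc_node (ltnW st)|apply: arc_node st].
  - move/eqP: hE; rewrite -(arc_first ej) /head_pt (arc_nth_eq ej) //.
    by apply: leq_ltn_trans sj.
  - move/eqP: hE; rewrite -(arc_last ej) /head_pt (arc_nth_eq ej) //; last by lia.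
    by move/eqP; lia.
move: st tj; rewrite /tail_pt /head_pt tjE => st.
rewrite !(arc_nth_eq ej) ?(ltnW st) // eqSS => /orP[]/eqP tE; apply/orP; [right|left].
  by rewrite [t]surjective_pairing tjE; apply/eqP; congr pair; apply: val_inj; rewrite /= tE kE.
by rewrite [t]surjective_pairing [j]surjective_pairing tjE; apply/eqP; congr pair; apply: val_inj.
Qed.

Section Flow.
Variable z : rel G.
Hypotheses (zs : symmetric z) (ze : subrel z e) (zev : even_rel z).
Definition flow : pred piece := fun j => z j.1.1 j.1.2.

(** The sum telescopes along each arc to the two end vertices, and there it
    vanishes because [z] is even. *)
Lemma flow_balanced : balanced valid lft rgt flow.
Proof.
move=> f; pose g p := f (coord c p).
have E j : f (lft j) (+) f (rgt j) = g (tail_pt j) (+) g (head_pt j).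
  by rewrite /lft /rgt; case: ifP => // _; rewrite addbC.
under eq_bigr => j _ do rewrite E.
pose Q (p : G * G) := [&& z p.1 p.2 & (rk p.1 < rk p.2)%N].
transitivity (\big[addb/false]_(p : G * G | Q p) (g (pos p.1) (+) g (pos p.2))).
  transitivity (\big[addb/false]_(p : G * G | Q p)
     \big[addb/false]_(k < bound.+1 | (k < (size (arc p.1 p.2)).-1)%N)
       (g (arc p.1 p.2)`_k (+) g (arc p.1 p.2)`_k.+1)).
    rewrite pair_big_dep; apply: eq_bigl => -[[x y] k] /=.
    rewrite /valid /flow /Q /= -ltnS; case zxy: (z x y); rewrite ?andbF // (ze zxy) /= andbT.
    case: (_ < _)%N => //=; have := arc_size (ze zxy).
    by case: (size _) => //.
  apply: eq_bigr => -[x y] /= /andP[/= zxy _]; have xy := ze zxy.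
  rewrite -(big_ord_widen _ (fun k => g (arc x y)`_k (+) g (arc x y)`_k.+1)); last first.
    by apply: leq_trans (leq_pred _) _; apply: leqW; apply: size_bound.
  rewrite -(arc_first xy) -(arc_last xy).
  elim: (size _).-1 => [|m IHm]; first by rewrite big_ord0 addbb.
  by rewrite big_ord_recr /= IHm addbA addbK.
rewrite big_split /=.
have -> : \big[addb/false]_(p | Q p) g (pos p.2) =
          \big[addb/false]_(p : G * G | z p.1 p.2 && (rk p.2 < rk p.1)%N) g (pos p.1).
  rewrite (reindex_inj (h := fun p : G * G => (p.2, p.1))) /=; last first.
    by move=> [? ?] [? ?] [-> ->].
  by apply: eq_bigl => -[x y]; rewrite /Q /= zs.
have -> : \big[addb/false]_(p | Q p) g (pos p.1) =
    \big[addb/false]_(p : G * G | z p.1 p.2 && (rk p.1 < rk p.2)%N) g (pos p.1) by [].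
transitivity (\big[addb/false]_(p : G * G | z p.1 p.2) g (pos p.1)).
  rewrite [RHS](bigID (fun p : G * G => (rk p.1 < rk p.2)%N)) /=; congr addb.
  apply: eq_bigl => -[x y] /=; case zxy: (z x y) => //=; rewrite -leqNgt [RHS]leq_eqVlt.
  case: eqP => [/val_inj/enum_rank_inj yx|//].
  by move: (ze zxy); rewrite yx ei.
rewrite -(pair_big_dep xpredT z (fun x y => g (pos x))) /= big1 // => x _.
case: (g (pos x)); last by rewrite big1.
by rewrite -[RHS](zev x) big_mkcond; apply: eq_bigr => y _; case: (z x y).
Qed.

Local Notation side := (side valid lft rgt flow).

Lemma side_other j : valid j ->
  side (coord c (tail_pt j)) j (+) side (coord c (head_pt j)) j = flow j.
Proof.
move=> vj; rewrite -(side_ends lft_rgt segments_noncross vj flow_balanced) /lft /rgt.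
by case: ifP => // _; rewrite addbC.
Qed.

(** The face to the left of an arc does not change at its break points. *)
Lemma side_first x y i : e x y -> (rk x < rk y)%N -> (i.+1 < size (arc x y))%N ->
  side (coord c (arc x y)`_i) (x, y, inord i) = side (coord c (pos x)) (x, y, inord 0).
Proof.
move=> xy lt; rewrite -(arc_first xy).
have kE k : (k < size (arc x y))%N -> (inord k : 'I_bound.+1) = k :> nat.
  by move=> kn; rewrite inordK // ltnS; apply: leq_trans (ltnW kn) (size_bound x y).
elim: i => // i IHi si2; have si := ltnW si2; rewrite -(IHi si).
pose j : piece := (x, y, inord i); pose j' : piece := (x, y, inord i.+1).
have vj : valid j by rewrite /valid xy lt /= kE // ltnW.
have vj' : valid j' by rewrite /valid xy lt /= kE.
have hj : head_pt j = (arc x y)`_i.+1 by rewrite /head_pt /= kE // ltnW.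
have tj : tail_pt j = (arc x y)`_i by rewrite /tail_pt /= kE // ltnW.
have jj' : j != j'.
  apply/eqP => -[/(congr1 val)] /=; rewrite !kE //; last exact: ltnW.
  by move/eqP; rewrite -[_ == _]/(i == i.+1) ltn_eqF.
have := side_straight lft_rgt segments_noncross vj vj' jj' (p := coord c (head_pt j)) _ (z := flow) erefl.
have bp : forall t, valid t && incident lft rgt (coord c (head_pt j)) t = (t == j) || (t == j').
  move=> t; rewrite break_point //; last by rewrite /= kE // ltnW.
  by rewrite /j' /= kE // ltnW.
move=> /(_ bp); rewrite -(side_other vj) hj tj.
by case: (side _ j); case: (side _ j); case: (side _ j').
Qed.

Definition left_face x y := side (coord c (pos x)) (first_piece x y).

Lemma left_face_flip x y : e x y -> left_face x y (+) left_face y x = z x y.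
Proof.
wlog lt : x y / (rk x < rk y)%N => [H|] xy.
  have [|/negbTE/(edge_order xy) lt] := boolP (rk x < rk y)%N; first by move/H; apply.
  by rewrite addbC zs H // es.
rewrite /left_face /first_piece lt ltnNge (ltnW lt) /=.
have s1 := arc_size xy; set n := (size (arc x y)).-2.
have nE : n.+2 = size (arc x y) by rewrite /n; case: (size _) s1 => [|[|]].
rewrite -(@side_first x y n) //; last by rewrite -nE.
have kE : (inord n : 'I_bound.+1) = n :> nat by exact: last_pieceK.
have vj : valid (x, y, inord n) by rewrite /valid /= xy lt kE -nE leqnn.
have := side_other vj; rewrite /tail_pt /head_pt /= kE.
by rewrite -(arc_last xy) -nE.
Qed.
End Flow.

(** Neighbours of [x] in clockwise order of the initial pieces of their arcs. *)
Definition turn x : rel G := fun y y' =>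
  before lft rgt (coord c (pos x)) (first_piece x y) (first_piece x y').

Lemma left_faceE z x y : symmetric z -> subrel z e -> e x y ->
  left_face z x y = upward valid lft rgt (flow z) (coord c (pos x)) (+)
    \big[addb/false]_(y' | z x y') turn x y' y.
Proof.
move=> zs ze xy; rewrite /left_face side_incident; congr addb.
rewrite (eq_bigl (fun t => t \in first_piece x @: [set y | e x y])) => [|t]; last first.
  by rewrite -(incident_set xy) inE.
rewrite big_imset /=; last exact: first_piece_inj.
rewrite (eq_bigl (e x)) => [|y']; last by rewrite inE.
rewrite big_mkcond [RHS]big_mkcond /=; apply: eq_bigr => y' _.
case exy: (e x y'); last by case zxy: (z x y') => //; rewrite (ze _ _ zxy) in exy.
suff -> : flow z (first_piece x y') = z x y' by case: (z x y').
by rewrite /flow /first_piece; case: ifP => // _; rewrite zs.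
Qed.

Lemma turn_irr x y : ~~ turn x y y.
Proof. exact: before_irr. Qed.

Lemma turn_total x : {in [set y | e x y] &, forall y y', y != y' -> turn x y y' (+) turn x y' y}.
Proof.
move=> y y' yN y'N yy'; have [xy xy'] : e x y /\ e x y' by rewrite !inE in yN y'N.
apply: (before_total lft_rgt segments_noncross);
  rewrite ?first_piece_valid ?first_piece_incident //.
by apply: contraNneq yy' => /(first_piece_inj yN y'N)/eqP.
Qed.

Lemma turn_trans x : transitive (turn x).
Proof. by move=> y y' y''; apply: before_trans. Qed.

Definition next_turn x y := odflt x [pick t | is_next [set t | e y t] (turn y) x t].

Lemma next_turnP x y : e x y -> is_next [set t | e y t] (turn y) x (next_turn x y).
Proof.
move=> xy; rewrite /next_turn; case: pickP => //= no.
have xN : x \in [set t | e y t] by rewrite inE es.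
have [t] := is_next_ex (in1W (turn_irr y)) (in3W (turn_trans (x := y))) xN.
by rewrite no.
Qed.

Lemma plane_short_cycle : (exists x y, e x y) -> (forall x, (deg e x <= 3)%N) ->
  (forall x, deg e x != 1%N) ->
  exists c, [/\ ucycle e c, (2 < size c)%N & (count (fun x => deg e x == 3%N) c <= 5)%N].
Proof.
move=> ex d3 d1; apply: (@short_cycle _ e next_turn) => //.
  move=> x y xy; have yx : e y x by rewrite es.
  have xN : x \in [set t | e y t] by rewrite inE.
  have nxt := next_turnP xy; have /andP[nN _] := nxt.
  rewrite inE in nN; rewrite nN /=.
  apply: (is_next_neq (in1W (turn_irr y)) (@turn_total y) xN _ nxt).
  by rewrite -/(deg e y) ltn_neqAle eq_sym d1; apply/card_gt0P; exists x.
move=> z zs ze zev; exists (left_face z) => x y xy; split; last exact: left_face_flip.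
have yx : e y x by rewrite es.
have xN : x \in [set t | e y t] by rewrite inE.
have nxt := next_turnP xy; have /andP[nN _] := nxt; rewrite inE in nN.
have zN k : z y k -> k \in [set t | e y t] by move=> /ze; rewrite inE.
rewrite left_faceE //.
rewrite (is_next_parity (in1W (turn_irr y)) (@turn_total y) (in3W (turn_trans (x := y))) xN nxt zN (zev y)).
rewrite addbA -left_faceE // -(left_face_flip zs ze zev yx).
by rewrite addKb.
Qed.

End Pieces.
End Drawing.

Theorem planar_sparse (R : realType) (G : sgraph) :
  subcubic G -> planar R G -> sparse (@adj G).
Proof.
move=> sub [pos [arc dr]] e es eadj ex d1.
have [|c gen] := @generic_direction R _ (enum (@valid R G arc e)) (@tail_pt R G arc) (@head_pt R G arc).
  move=> j; rewrite mem_enum => /and3P[ej oj sj].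
  by rewrite /tail_pt /head_pt (arc_nth_eq dr eadj ej) // 1?ltnW // ltn_eqF.
apply: (plane_short_cycle dr es eadj (c := c)) => // [j vj|x].
  by apply: gen; rewrite mem_enum.
by apply: leq_trans (sub x); apply: leq_deg.
Qed.

Local Close Scope ring_scope.

(** * Squares of planar graphs *)

Lemma square_adj_sq (G : sgraph) (u v : G) : square_adj u v -> sq (@adj G) u v.
Proof.
rewrite /square_adj /sq /= => /andP[uv /existsP[p /andP[]]]; rewrite uv.
case: p => -[|a [|b [|//]]] //= _.
- by move=> _; rewrite (negPf uv).
- by rewrite andbT => ua /eqP <-; rewrite ua.
rewrite andbT => /andP[ua ab] /eqP <-; apply/orP; right; apply/existsP; exists a.
by rewrite ua ab.
Qed.

Lemma square_choosable (G : sgraph) : good (@adj G) -> choosable 7 (square G).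
Proof.
move=> gG C L szL; have [g Lg pg] := good_colorable szL gG.
by exists g; split=> // u v /square_adj_sq uv; apply/eqP/pg.
Qed.

Theorem theorem4 (R : realType) (G : sgraph) :
  subcubic G -> planar R G -> ~ has_cycle 4 G -> ~ has_cycle 5 G ->
  (list_chromatic_number (square G) <= 7)%N.
Proof.
move=> sub plG no4 no5.
have gG : good (@adj G).
  split; [exact: adj_sym|exact: adj_irrefl|exact: sub| | |exact: planar_sparse sub plG].
    by move=> c cc; apply/eqP => sc; apply: no4; exists c.
  by move=> c cc; apply/eqP => sc; apply: no5; exists c.
rewrite /list_chromatic_number; case: ex_minnP => m _; apply.
exact/asboolP/square_choosable.
Qed.
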